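(* Let $A$ be an even, invertible linear operator on an $n|m$-dimensional superspace $V$, diagonal in a homogeneous basis $e_1,\dots,e_n$ (even), $e_{\hat 1},\dots,e_{\hat m}$ (odd) with even eigenvalues $x_1,\dots,x_n$ and $y_1,\dots,y_m$ respectively, where $|y_1|<\dots<|y_m|$. Then $$\operatorname{Ber}(E+zA)=\sum_{r\ge0}z^r(-1)^r\operatorname{Str}S^r(A^\Pi)$$ for $z$ near zero.
   Context: $V$ is an $n|m$-dimensional vector superspace (more precisely, a free module of rank $n|m$ over an auxiliary Grassmann algebra over $\mathbb C$); $E$ is the identity operator; $\operatorname{Ber}$ is the Berezinian; $\operatorname{Str}$ is the supertrace. Absolute values and inequalities for elements of the Grassmann algebra refer to their numerical parts. All $y_\mu$ and all differences $y_\mu-y_\nu$ ($\mu\neq\nu$) are invertible. ''$z$ near zero'' means $|z|<1/|y_m|$. $\Pi$ is parity reversion; $A^\Pi$ is the operator induced by $A$ on $\Pi V$, and $S^r(A^\Pi)$ is the induced operator on the (super)symmetric power $S^r(\Pi V)$. If $\varepsilon_A=\Pi e_A$, then $\varepsilon_1,\dots,\varepsilon_n$ are odd, $\varepsilon_{\hat1},\dots,\varepsilon_{\hat m}$ are even, and $S^r(\Pi V)$ has basis $(\varepsilon_1)^{k_1}\cdots(\varepsilon_n)^{k_n}(\varepsilon_{\hat1})^{i_1}\cdots(\varepsilon_{\hat m})^{i_m}$ with $k_a\in\{0,1\}$, $i_\mu\in\mathbb Z_{\ge0}$, $\sum k_a+\sum i_\mu=r$; this vector has parity $\sum k_a\bmod2$.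 *)

(* Defs.v *)
From HB Require Import structures.
From mathcomp Require Import all_boot all_order all_algebra.
From mathcomp Require Import complex ring.
From mathcomp Require Import boolp reals topology normedtype sequences.
(* The notations of mpoly clash with those of the analysis library. *)
From mathcomp Require Import -(notations) mpoly.

Set Implicit Arguments.
Unset Strict Implicit.
Unset Printing Implicit Defensive.

Import Order.TTheory GRing.Theory Num.Theory numFieldNormedType.Exports.
Local Open Scope ring_scope.

Definition invertible (R : pzRingType) (x : R) : Prop :=
  exists y, y * x = 1 /\ x * y = 1.

Definition inverse (R : pzRingType) (x : R) : R :=
  if pselect (invertible x) is left h then projT1 (cid h) else x.

Lemma inverseP (R : pzRingType) (x : R) :
  invertible x -> inverse x * x = 1 /\ x * inverse x = 1.
Proof.
by rewrite /inverse; case: pselect => // h _; case: (cid h).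
Qed.

(* An element is the family of its coefficients on the basis
   theta_S = theta_(i_1) ... theta_(i_k), for S = {i_1 < ... < i_k}. *)

Definition grassmann (K : comNzRingType) (N : nat) : Type :=
  {ffun {set 'I_N} -> K}.

HB.instance Definition _ (K : comNzRingType) (N : nat) :=
  GRing.Zmodule.copy (grassmann K N) {ffun {set 'I_N} -> K}.

Section GrassmannRing.
Variables (K : comNzRingType) (N : nat).
Implicit Types (S T U V : {set 'I_N}) (x y z : grassmann K N).

(* theta_T * theta_U = (-1) ^ inversions T U * theta_(T :|: U)
   when T and U are disjoint. *)
Definition inversions T U : nat :=
  #|[set p : 'I_N * 'I_N | [&& p.1 \in T, p.2 \in U & (p.2 < p.1)%N]]|.

Definition gr_one : grassmann K N := [ffun S => (S == set0)%:R].

Definition gr_mul x y : grassmann K N :=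
  [ffun S : {set 'I_N} => \sum_(T : {set 'I_N} | T \subset S)
     (-1) ^+ inversions T (S :\: T) * (x T * y (S :\: T))].

Lemma inversionsUl T U V : [disjoint T & U] ->
  inversions (T :|: U) V = (inversions T V + inversions U V)%N.
Proof.
move=> dTU; rewrite /inversions.
rewrite -cardsUI [X in (_ + X)%N](_ : _ = 0%N) ?addn0.
  by apply: eq_card => p; rewrite !inE andb_orl.
apply: eq_card0 => p; rewrite !inE; apply/negP => /andP[/and3P[pT _ _]].
by case/and3P=> pU _ _; move: dTU => /disjointFr/(_ pT); rewrite pU.
Qed.

Lemma inversionsUr T U V : [disjoint U & V] ->
  inversions T (U :|: V) = (inversions T U + inversions T V)%N.
Proof.
move=> dUV; rewrite /inversions.
rewrite -cardsUI [X in (_ + X)%N](_ : _ = 0%N) ?addn0.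
  by apply: eq_card => p; rewrite !inE -andb_orr andb_orl.
apply: eq_card0 => p; rewrite !inE; apply/negP => /andP[/and3P[_ pU _]].
by case/and3P=> _ pV _; move: dUV => /disjointFr/(_ pU); rewrite pV.
Qed.

Lemma inversions0l U : inversions set0 U = 0%N.
Proof. by apply: eq_card0 => p; rewrite !inE. Qed.

Lemma inversions0r U : inversions U set0 = 0%N.
Proof. by apply: eq_card0 => p; rewrite !inE andbF. Qed.

Lemma gr_mulA : associative gr_mul.
Proof.
move=> x y z; apply/ffunP => S; rewrite !ffunE.
pose F (U W V : {set 'I_N}) : K :=
  (-1) ^+ (inversions U W + inversions U V + inversions W V)
    * (x U * (y W * z V)).
transitivity (\sum_(U : {set 'I_N} | U \subset S)
   \sum_(T : {set 'I_N} | (T \subset S) && (U \subset T))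
     F U (T :\: U) (S :\: T)).
  apply: eq_bigr => U sUS; rewrite ffunE 2!mulr_sumr.
  rewrite (reindex_onto (fun T => T :\: U) (fun W => U :|: W)) /=; last first.
    move=> W sW; rewrite setDUl setDv set0U; apply/setDidPl.
    by move: sW; rewrite subsetD => /andP[].
  have bij (T : {set 'I_N}) : (T :\: U \subset S :\: U) && (U :|: T :\: U == T)
       = (T \subset S) && (U \subset T).
    have -> : U :|: T :\: U = U :|: T.
      by apply/setP=> i; rewrite !inE; case: (i \in U).
    rewrite (sameP eqP setUidPr) [RHS]andbC andbC.
    case sUT: (U \subset T) => //=; apply/idP/idP => [s|]; last exact: setSD.
    rewrite -(setID T U) subUset (subset_trans (subsetIr _ _) sUS) /=.
    exact: subset_trans s (subsetDl _ _).
  apply: eq_big => [T|T]; first exact: bij.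
  rewrite bij => /andP[sTS sUT].
  have eV : (S :\: U) :\: (T :\: U) = S :\: T.
    by apply/setP=> i; rewrite !inE; case: (boolP (i \in U)) => [/(subsetP sUT)->|]; rewrite ?andbF.
  have eW : S :\: U = (T :\: U) :|: (S :\: T).
    apply/setP=> i; rewrite !inE; have := subsetP sTS i; have := subsetP sUT i.
    by case: (i \in U); case: (i \in T); case: (i \in S) => //= a b;
       rewrite ?a ?b //; move: (a isT) (b isT).
  rewrite eV {1}eW inversionsUr; last first.
    by rewrite -setI_eq0; apply/eqP/setP=> i; rewrite !inE; case: (i \in T);
       rewrite ?andbF.
  by rewrite /F !exprD !mulrA; congr (_ * _ * _); rewrite -!mulrA [x U * _]mulrC !mulrA.
rewrite (exchange_big_dep (fun T => T \subset S)) /=; last by move=> U T _ /andP[].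
apply: eq_bigr => T sTS; rewrite ffunE mulr_suml mulr_sumr.
apply: eq_big => [U|U].
  by rewrite sTS /=; case sUT: (U \subset T); rewrite ?andbF // (subset_trans sUT sTS).
case/andP=> sUS /andP[_ sUT].
have eT : T = U :|: (T :\: U).
  by apply/setP=> i; rewrite !inE; case: (boolP (i \in U)) => // /(subsetP sUT).
have -> : inversions T (S :\: T)
    = (inversions U (S :\: T) + inversions (T :\: U) (S :\: T))%N.
  rewrite {1}eT inversionsUl //.
  by rewrite -setI_eq0; apply/eqP/setP=> i; rewrite !inE; case: (i \in U).
by rewrite /F !exprD; ring.
Qed.

Lemma gr_mul1l : left_id gr_one gr_mul.
Proof.
move=> x; apply/ffunP => S; rewrite ffunE (bigD1 set0) ?sub0set //= big1.
  by rewrite ffunE eqxx mul1r setD0 inversions0l expr0 mul1r addr0.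
by move=> T /andP[_ /negPf nT]; rewrite ffunE nT mul0r mulr0.
Qed.

Lemma gr_mul1r : right_id gr_one gr_mul.
Proof.
move=> x; apply/ffunP => S; rewrite ffunE (bigD1 S) ?subxx //= big1.
  by rewrite ffunE setDv eqxx mulr1 inversions0r expr0 mul1r addr0.
move=> T /andP[sTS nT]; rewrite ffunE setD_eq0 [S \subset T]negbTE ?mulr0 //.
by apply: contra nT => sST; rewrite eqEsubset sTS.
Qed.

Lemma gr_mulDl : left_distributive gr_mul +%R.
Proof.
move=> x y z; apply/ffunP => S; rewrite !ffunE -big_split /=.
by apply: eq_bigr => T _; rewrite ffunE mulrDl mulrDr.
Qed.

Lemma gr_mulDr : right_distributive gr_mul +%R.
Proof.
move=> x y z; apply/ffunP => S; rewrite !ffunE -big_split /=.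
by apply: eq_bigr => T _; rewrite ffunE mulrDr mulrDr.
Qed.

Lemma gr_one_neq0 : gr_one != 0 :> grassmann K N.
Proof.
by apply/eqP => /ffunP/(_ set0); rewrite !ffunE eqxx => /eqP; rewrite oner_eq0.
Qed.

End GrassmannRing.

HB.instance Definition _ (K : comNzRingType) (N : nat) :=
  GRing.Zmodule_isNzRing.Build (grassmann K N)
    (@gr_mulA K N) (@gr_mul1l K N) (@gr_mul1r K N)
    (@gr_mulDl K N) (@gr_mulDr K N) (@gr_one_neq0 K N).

Section GrassmannUnit.
Variables (K : comNzRingType) (N : nat).

Definition gr_unit : pred (grassmann K N) := fun x => `[< invertible x >].

Lemma gr_mulVr : {in gr_unit, left_inverse 1 (@inverse (grassmann K N)) *%R}.
Proof. by move=> x /asboolP /inverseP[]. Qed.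

Lemma gr_mulrV : {in gr_unit, right_inverse 1 (@inverse (grassmann K N)) *%R}.
Proof. by move=> x /asboolP /inverseP[]. Qed.

Lemma gr_unitP (x y : grassmann K N) : y * x = 1 /\ x * y = 1 -> gr_unit x.
Proof. by move=> h; apply/asboolP; exists y. Qed.

Lemma gr_invr_out : {in [predC gr_unit], @inverse (grassmann K N) =1 id}.
Proof. by move=> x /asboolPn nx; rewrite /inverse; case: pselect. Qed.

End GrassmannUnit.

HB.instance Definition _ (K : comNzRingType) (N : nat) :=
  GRing.NzRing_hasMulInverse.Build (grassmann K N)
    (@gr_mulVr K N) (@gr_mulrV K N) (@gr_unitP K N) (@gr_invr_out K N).

Section GrassmannMisc.
Variables (K : comNzRingType) (N : nat).

(* [p] is the parity: [false] for even elements, [true] for odd ones. *)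
Definition gr_homog (p : bool) (x : grassmann K N) : Prop :=
  forall S : {set 'I_N}, x S != 0 -> odd #|S| = p.

Definition body (x : grassmann K N) : K := x set0.

Definition gr_gen (i : 'I_N) : grassmann K N := [ffun S => (S == [set i])%:R].

(* The Grassmann algebra on [q + N] generators xi_1, .., xi_q, eta_1, .., eta_N
   contains the one on the eta's, and is a free right module over it with
   basis the monomials xi_Q. *)
Definition gr_embed (q : nat) (x : grassmann K N) : grassmann K (q + N) :=
  [ffun S : {set 'I_(q + N)} =>
     if @lshift q N @^-1: S == set0 then x (@rshift q N @^-1: S) else 0].

Definition gr_coef (q : nat) (Q : {set 'I_q}) (s : grassmann K (q + N)) :
    grassmann K N :=
  [ffun T : {set 'I_N} => s (@lshift q N @: Q :|: @rshift q N @: T)].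

End GrassmannMisc.

(* L^(n|m) is the right [L]-module of column vectors, whose first [n]
   standard basis vectors are even and last [m] ones odd; the columns of the
   matrix of an operator are the images of the basis vectors. *)

Section Superalgebra.
Variables (K : comNzRingType) (N : nat).
Notation L := (grassmann K N).

Section Super.
Variables n m : nat.

Definition sparity (i : 'I_(n + m)) : bool := (n <= i)%N.

Definition smx_even (A : 'M[L]_(n + m)) : Prop :=
  forall i j, gr_homog (sparity i (+) sparity j) (A i j).

Definition vec_homog (p : bool) (v : 'cV[L]_(n + m)) : Prop :=
  forall i, gr_homog (sparity i (+) p) (v i 0).

Definition homogeneous_basis (e : 'I_n -> 'cV[L]_(n + m))
    (eh : 'I_m -> 'cV[L]_(n + m)) : Prop :=
  [/\ forall a, vec_homog false (e a),
      forall mu, vec_homog true (eh mu) &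
      forall v : 'cV[L]_(n + m), exists! c : 'cV[L]_(n + m),
        v = \sum_(a < n) e a *m (c (lshift m a) 0)%:M
          + \sum_(mu < m) eh mu *m (c (rshift n mu) 0)%:M].

(* For an even matrix, both determinants involve even elements only, which
   commute with each other. *)
Definition Ber (A : 'M[L]_(n + m)) : L :=
  \det (ulsubmx A - ursubmx A *m inverse (drsubmx A) *m dlsubmx A)
  / \det (drsubmx A).

(* The matrix of A^Pi on L^(m|n), in the basis Pi e_(n+1), .., Pi e_(n+m),
   Pi e_1, .., Pi e_n; there is no sign since Pi (v c) = (Pi v) c and
   A^Pi (Pi v) = Pi (A v). *)
Definition parity_reversed (A : 'M[L]_(n + m)) : 'M[L]_(m + n) :=
  block_mx (drsubmx A) (dlsubmx A) (ursubmx A) (ulsubmx A).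

End Super.

Definition Str (I : finType) (par : I -> bool) (T : I -> I -> L) : L :=
  \sum_(i : I) (-1) ^+ par i * T i i.

(* The symmetric superalgebra S(W) of W = L^(p|q) is the algebra of
   polynomials in the [p] even basis vectors of W, with coefficients in the
   Grassmann algebra on the [q] odd basis vectors of W and the [N] generators
   of [L]. *)

Section SymmetricPower.
Variables p q : nat.

Definition sym_alg := mpoly p (grassmann K (q + N)).

Definition sym_gen (i : 'I_(p + q)) : sym_alg :=
  match split i with
  | inl mu => mpolyX _ (mnm1 mu)
  | inr a => mpolyC p (gr_gen K (lshift N a))
  end.

Definition sym_embed (c : L) : sym_alg := mpolyC p (gr_embed q c).

(* A basis vector of S^r(W) is the product of the odd generators in a set
   [b.2], in increasing order, and of the even generators with exponents
   [b.1]. *)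
Definition sym_basis (r : nat) : finType :=
  {b : bmultinom p r.+1 * {set 'I_q} | (mdeg b.1 + #|b.2|)%N == r}.

Definition sym_parity (r : nat) (b : sym_basis r) : bool := odd #|(val b).2|.

(* Coefficients are on the right of the basis vectors. *)
Definition sym_coef (r : nat) (b : sym_basis r) (s : sym_alg) : L :=
  gr_coef (val b).2 (mcoeff (val b).1 s).

Definition sym_image (B : 'M[L]_(p + q)) (j : 'I_(p + q)) : sym_alg :=
  \sum_(i < p + q) sym_gen i * sym_embed (B i j).

(* The matrix of the induced operator w_1 ... w_r |-> B w_1 ... B w_r. *)
Definition sym_power (r : nat) (B : 'M[L]_(p + q)) (b b' : sym_basis r) : L :=
  sym_coef b
    ((\prod_(a < q | a \in (val b').2) sym_image B (rshift p a)) *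
     (\prod_(mu < p) sym_image B (lshift q mu) ^+ (bmnm (val b').1 mu))).

End SymmetricPower.

End Superalgebra.

Local Open Scope classical_set_scope.
Local Open Scope complex_scope.

Definition gr_series_cvg (R : realType) (N : nat)
    (u : nat -> grassmann R[i] N) (l : grassmann R[i] N) : Prop :=
  forall S : {set 'I_N}, series (fun r => u r S : R[i]^o) @ \oo --> (l S : R[i]^o).

(* Main.v *)
Require Import Defs.
From HB Require Import structures.
From mathcomp Require Import all_boot all_order all_algebra.
From mathcomp Require Import complex reals.
From mathcomp Require Import -(notations) mpoly.

Set Implicit Arguments.
Unset Strict Implicit.
Unset Printing Implicit Defensive.

Import GRing.Theory Num.Theory.
Local Open Scope ring_scope.

(** Conjugation reduces everything to a diagonal operator, for which both sides
    are the same explicit function of the eigenvalues.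

    Let P be the matrix of the eigenvectors and D the diagonal matrix of the
    eigenvalues x_a and y_mu, so that A P = P D. The matrix P is invertible and
    even, and so is its inverse (smx_even_inv).

    - The Berezinian does not change under conjugation, so that
      Ber (1 + z A) = prod_a (1 + z x_a) / prod_mu (1 + z y_mu) (Ber_eigen). After
      block elimination the odd blocks of A and P only contribute factors
      det (1 - k g) and det (1 - g k) with k and g odd; they cancel because these
      two determinants are inverse to each other (det_odd_mulC).

    - The supertrace does not change either. The symmetric power is a functor
      (sym_power_mulmx): a change of generators extends to an endomorphism of
      the free supercommutative algebra S(W) (sym_alg_universal), which rests on
      the universal property of Grassmann algebras (gr_universal). Since the
      supertrace is cyclic (Str_mulC), Str S^r(A^Pi) is the supertrace of the
      diagonal operator, namely the sum of (-1)^|Q| x^Q y^k over the basis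
      vectors, which are indexed by a set Q and a multi-index k with
      |Q| + |k| = r (sym_power_diag).

    With c_a = z x_a and u_mu = - z y_mu, the term of index r of the series is
    therefore the coefficient of X^r in prod_a (1 + c_a X) / prod_mu (1 - u_mu X)
    (sym_basis_sum, geom_coefE), and the sum of the series is the value at
    X = 1. For the convergence, factors 1 / (1 - u X) are introduced one at a
    time: the partial sums then satisfy s_(M+1) = u s_M + t_(M+1), where t are
    the partial sums without this factor, and such a recursion converges to
    lim t / (1 - u) as soon as the body of u is smaller than one in absolute
    value (gr_cvg_geometric). *)

(** * Parity and supercommutativity *)

Lemma sum_neq0 (V : nmodType) (I : finType) (P : pred I) (F : I -> V) :
  \sum_(i | P i) F i != 0 -> exists2 i, P i & F i != 0.
Proof.
move=> nz; apply/exists_inP; apply: contra_neqT nz => /exists_inPn nF.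
by apply: big1 => i Pi; apply/eqP; rewrite -[_ == _]negbK nF.
Qed.

Section Grading.
Variables (K : comNzRingType) (N : nat).
Notation L := (grassmann K N).
Implicit Types (x y z : L) (S T U : {set 'I_N}) (p q : bool).

Lemma grD x y S : (x + y) S = x S + y S. Proof. by rewrite ffunE. Qed.
Lemma grN x S : (- x) S = - x S. Proof. by rewrite ffunE. Qed.
Lemma gr0 S : (0 : L) S = 0. Proof. by rewrite ffunE. Qed.
Lemma gr1 S : (1 : L) S = (S == set0)%:R. Proof. by rewrite ffunE. Qed.

Lemma gr_sum (I : Type) (r : seq I) (P : pred I) (F : I -> L) S :
  (\sum_(i <- r | P i) F i) S = \sum_(i <- r | P i) F i S.
Proof.
by elim/big_rec2: _ => [|i a b _ <-]; rewrite ?gr0 ?grD.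
Qed.

Lemma grM x y S : (x * y) S =
  \sum_(T : {set 'I_N} | T \subset S)
     (-1) ^+ inversions T (S :\: T) * (x T * y (S :\: T)).
Proof. by rewrite ffunE. Qed.

Lemma gr_homog0 p : gr_homog p (0 : L).
Proof. by move=> S; rewrite gr0 eqxx. Qed.

Lemma gr_homog1 : gr_homog false (1 : L).
Proof. by move=> S; rewrite gr1; have [->|] := eqVneq S set0; rewrite ?cards0 ?eqxx. Qed.

Lemma gr_homogD p x y : gr_homog p x -> gr_homog p y -> gr_homog p (x + y).
Proof.
move=> hx hy S; rewrite grD; have [x0|/hx //] := eqVneq (x S) 0.
by rewrite x0 add0r; apply: hy.
Qed.

Lemma gr_homogN p x : gr_homog p x -> gr_homog p (- x).
Proof. by move=> hx S; rewrite grN oppr_eq0; apply: hx. Qed.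

Lemma gr_homog_sum (I : Type) (r : seq I) (P : pred I) (F : I -> L) p :
  (forall i, P i -> gr_homog p (F i)) -> gr_homog p (\sum_(i <- r | P i) F i).
Proof. by move=> hF; elim/big_ind: _ => //; [apply: gr_homog0|apply: gr_homogD]. Qed.

Lemma odd_cardD S T : T \subset S -> odd #|S| = odd #|T| (+) odd #|S :\: T|.
Proof. by move=> /setIidPr sTS; rewrite -(cardsID T) sTS oddD. Qed.

Lemma gr_homogM p q x y :
  gr_homog p x -> gr_homog q y -> gr_homog (p (+) q) (x * y).
Proof.
move=> hx hy S; rewrite grM => /sum_neq0[T sTS nz].
have xT : x T != 0 by apply: contraNneq nz => ->; rewrite mul0r mulr0.
have yT : y (S :\: T) != 0 by apply: contraNneq nz => ->; rewrite !mulr0.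
by rewrite (odd_cardD sTS) (hx _ xT) (hy _ yT).
Qed.

(** A pair of T x U is an inversion in exactly one of the two orders, as its
    components are distinct. *)
Lemma inversionsC T U : [disjoint T & U] ->
  (inversions T U + inversions U T = #|T| * #|U|)%N.
Proof.
move=> dTU; rewrite -cardsX /inversions.
pose swap (p : 'I_N * 'I_N) := (p.2, p.1).
have swap_inj : injective swap by move=> [a b] [c d] [-> ->].
rewrite -(card_imset [set p | [&& p.1 \in U, p.2 \in T & (p.2 < p.1)%N]] swap_inj).
rewrite -cardsUI [X in (_ + X)%N](_ : _ = 0%N) ?addn0; last first.
  apply: eq_card0 => -[i j]; rewrite !inE /=; apply/negP => /andP[/and3P[_ _ lji]].
  by case/imsetP=> -[a b]; rewrite !inE /= => /and3P[_ _ lab] [ei ej]; move: lji lab;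
     rewrite ei ej => /ltnW; rewrite leqNgt => /negbTE->.
apply: eq_card => -[i j]; rewrite !inE /=.
have -> : ((i, j) \in swap @: [set p | [&& p.1 \in U, p.2 \in T & (p.2 < p.1)%N]])
  = [&& j \in U, i \in T & (i < j)%N].
  apply/imsetP/idP => [[[a b]] | h]; first by rewrite inE /= => h [-> ->].
  by exists (j, i); rewrite ?inE.
rewrite andbCA -andb_orr -andb_orr; case iT: (i \in T); last by rewrite andbF.
rewrite /=.
case jU: (j \in U) => //=; rewrite -neq_ltn; apply: contraTneq jU => /val_inj ->.
by rewrite (disjointFr dTU iT).
Qed.

(** The coefficient of theta_S in x y is a sum over the decompositions of S in
    two parts T and U; exchanging the parts costs (-1)^(|T||U|), by inversionsC. *)
Lemma gr_supercomm p q x y : gr_homog p x -> gr_homog q y ->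
  x * y = (-1) ^+ (p && q) * (y * x).
Proof.
move=> hx hy; apply/ffunP=> S.
have -> : ((-1) ^+ (p && q) * (y * x)) S = (-1) ^+ (p && q) * (y * x) S.
  by case: (p && q); rewrite ?expr1 ?expr0 ?mul1r // !mulN1r grN.
rewrite !grM mulr_sumr (reindex_onto (fun T => S :\: T) (fun T => S :\: T)) /=; last first.
  by move=> T sTS; rewrite setDDr setDv set0U; apply/setIidPr.
apply: eq_big => T; first rewrite subsetDl /=.
  rewrite setDDr setDv set0U; apply/eqP/idP; first by move<-; apply: subsetIl.
  by move/setIidPr.
rewrite subsetDl /= => /eqP eT; rewrite eT.
have [->|xnz] := eqVneq (x (S :\: T)) 0; first by rewrite mul0r !mulr0.
have [->|ynz] := eqVneq (y T) 0; first by rewrite mul0r !mulr0.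
suff -> : (-1) ^+ inversions (S :\: T) T
    = (-1) ^+ (p && q) * (-1) ^+ inversions T (S :\: T) :> K.
  by rewrite -mulrA [x _ * _]mulrC.
rewrite -[LHS]signr_odd -[X in _ * X]signr_odd -signr_addb.
rewrite -(hx _ xnz) -(hy _ ynz) -oddM mulnC -inversionsC; last first.
  by rewrite -setI_eq0; apply/eqP/setP=> i; rewrite !inE; case: (i \in T).
by rewrite oddD addbAC addbb.
Qed.

Definition gr_part p x : L := [ffun S => x S *+ (odd #|S| == p)].

Lemma gr_part_homog p x : gr_homog p (gr_part p x).
Proof. by move=> S; rewrite ffunE; have [//|] := eqVneq (odd #|S|) p; rewrite mulr0n eqxx. Qed.

Lemma gr_even_comm x y : gr_homog false x -> x * y = y * x.
Proof.
move=> hx; have -> : y = gr_part false y + gr_part true y.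
  by apply/ffunP=> S; rewrite grD !ffunE; case: odd; rewrite ?addr0 ?add0r.
by rewrite mulrDl mulrDr !(gr_supercomm hx (@gr_part_homog _ _)) !expr0 !mul1r.
Qed.

Lemma gr_part_sum (I : Type) (r : seq I) (P : pred I) (F : I -> L) p :
  gr_part p (\sum_(i <- r | P i) F i) = \sum_(i <- r | P i) gr_part p (F i).
Proof.
by apply/ffunP=> S; rewrite ffunE !gr_sum -sumrMnl; apply: eq_bigr => i _; rewrite ffunE.
Qed.

(** The source of all evenness statements about inverses: if x is homogeneous
    and x y = 1, then a homogeneous component of y is already an inverse. *)
Lemma gr_partM p q x y : gr_homog p x ->
  gr_part (p (+) q) (x * y) = x * gr_part q y.
Proof.
move=> hx; apply/ffunP=> S; rewrite ffunE !grM -sumrMnl; apply: eq_bigr => T sTS.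
have [->|xnz] := eqVneq (x T) 0; first by rewrite !mul0r mulr0 mul0rn.
rewrite ffunE (odd_cardD sTS) (hx _ xnz) (inj_eq (@addbI p)).
by case: (_ == q); rewrite // !mulr0n ?mulr0.
Qed.

Lemma gr_part_id p x : gr_homog p x -> gr_part p x = x.
Proof.
move=> hx; apply/ffunP=> S; rewrite ffunE; have [->|/hx->] := eqVneq (x S) 0.
  by rewrite mul0rn.
by rewrite eqxx.
Qed.

End Grading.

(** * Free generation of Grassmann algebras *)

Section Universal.
Variables (K : comNzRingType) (N : nat).
Notation L := (grassmann K N).
Implicit Types (x y z : L) (S T U : {set 'I_N}).

Definition gr_scal (c : K) : L := [ffun S => c * (S == set0)%:R].

Lemma gr_scalM c x S : (gr_scal c * x) S = c * x S.
Proof.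
rewrite grM (bigD1 set0) ?sub0set //= big1 ?addr0.
  by rewrite ffunE eqxx inversions0l mul1r mulr1 setD0.
by move=> T /andP[_ /negPf nT]; rewrite ffunE nT mulr0 mul0r mulr0.
Qed.

Lemma gr_scal_additive : additive gr_scal.
Proof. by move=> a b; apply/ffunP=> S; rewrite grD grN !ffunE mulrBl. Qed.

Lemma gr_scal_multiplicative : multiplicative gr_scal.
Proof.
split=> [a b|]; apply/ffunP=> S; first by rewrite gr_scalM !ffunE mulrA.
by rewrite gr1 ffunE mul1r.
Qed.

HB.instance Definition _ := GRing.isAdditive.Build K L gr_scal gr_scal_additive.
HB.instance Definition _ :=
  GRing.isMultiplicative.Build K L gr_scal gr_scal_multiplicative.

Lemma gr_scal_homog c : gr_homog false (gr_scal c).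
Proof.
move=> S; rewrite ffunE; have [->|] := eqVneq S set0; first by rewrite cards0.
by rewrite mulr0 eqxx.
Qed.

Lemma body_additive : additive (@body K N).
Proof. by move=> x y; rewrite /body grD grN. Qed.

Lemma body_multiplicative : multiplicative (@body K N).
Proof.
split=> [x y|]; last by rewrite /body gr1 eqxx.
rewrite /body grM (bigD1 set0) ?sub0set //= big1 ?addr0.
  by rewrite setD0 inversions0l mul1r.
by move=> T; rewrite subset0 => /andP[->].
Qed.

HB.instance Definition _ := GRing.isAdditive.Build L K (@body K N) body_additive.
HB.instance Definition _ :=
  GRing.isMultiplicative.Build L K (@body K N) body_multiplicative.

Definition gr_mon T : L := [ffun S => (S == T)%:R].

Lemma gr_monE x : x = \sum_T gr_scal (x T) * gr_mon T.
Proof.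
apply/ffunP=> S; rewrite gr_sum (bigD1 S) //= big1 ?addr0.
  by rewrite gr_scalM ffunE eqxx mulr1.
by move=> T /negPf nT; rewrite gr_scalM ffunE eq_sym nT mulr0.
Qed.

Lemma gr_monM T U : gr_mon T * gr_mon U =
  if [disjoint T & U] then (-1) ^+ inversions T U * gr_mon (T :|: U) else 0.
Proof.
have sgn c x S : ((-1) ^+ c * x) S = (-1) ^+ c * x S.
  rewrite -signr_odd -[(-1) ^+ c in RHS]signr_odd.
  by case: odd; rewrite ?mul1r // !mulN1r grN.
apply/ffunP=> S; rewrite grM; case: ifPn => dTU.
  rewrite sgn ffunE; have [->|nS] := eqVneq S (T :|: U).
    rewrite (bigD1 T) ?subsetUl //= big1 ?addr0; last first.
      by move=> V /andP[_ /negPf nV]; rewrite ffunE nV mul0r mulr0.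
    have -> : (T :|: U) :\: T = U.
      by rewrite setDUl setDv set0U; apply/setDidPl; rewrite disjoint_sym.
    by rewrite !ffunE !eqxx mulr1.
  rewrite mulr0 big1 // => V sVS; rewrite !ffunE.
  have [eV|] := eqVneq V T; last by rewrite mul0r mulr0.
  have [eU|] := eqVneq (S :\: V) U; last by rewrite mul1r mulr0.
  by case/eqP: nS; rewrite -eU -eV setUC setDE setUIl (setUidPl sVS) setUC setUCr setIT.
rewrite gr0 big1 // => V sVS; rewrite !ffunE.
have [eV|] := eqVneq V T; last by rewrite mul0r mulr0.
have [eU|] := eqVneq (S :\: V) U; last by rewrite mul1r mulr0.
case/negP: dTU; rewrite -eV -eU -setI_eq0; apply/eqP/setP=> i.
by rewrite !inE; case: (i \in V).
Qed.

Section Anticommuting.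
Variables (A : nzRingType) (t : 'I_N -> A).
Hypothesis t_anti : forall i j, t i * t j = - (t j * t i).
Hypothesis t_sqr0 : forall i, t i * t i = 0.

Lemma anti_move (s : seq 'I_N) T b i :
  (\prod_(j <- s | j \in T) t j) * t i ^+ nat_of_bool b
  = (-1) ^+ (b * count [in T] s)
    * (t i ^+ nat_of_bool b * \prod_(j <- s | j \in T) t j).
Proof.
case: b; last by rewrite !expr0 !mul1r mulr1.
rewrite mul1n !expr1; elim: s => [|j s IH]; first by rewrite !big_nil mulr1 !mul1r.
rewrite !big_cons /=; case: (j \in T) => //=; rewrite -mulrA IH.
rewrite exprS mulN1r [LHS]mulrA commr_sign -[LHS]mulrA mulNr -mulrN; congr (_ * _).
by rewrite [LHS]mulrA t_anti mulNr mulrA.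
Qed.

(** Induction on s. If the head i of s belongs to U, then t i, taken in the
    second product, has to cross the t a of the first one with a in T after i:
    one sign for each inversion with second component i. *)
Lemma anti_prod (s : seq 'I_N) T U : pairwise ltn (map val s) ->
  (\prod_(i <- s | i \in T) t i) * (\prod_(i <- s | i \in U) t i) =
  if has [in T :&: U] s then 0 else
    (-1) ^+ (\sum_(i <- s) \sum_(j <- s) [&& i \in T, j \in U & (j < i)%N])
    * \prod_(i <- s | i \in T :|: U) t i.
Proof.
elim: s => [|i s IH] /=; first by rewrite !big_nil !mulr1.
case/andP=> /allP lti /IH {}IH.
have lt_i j : j \in s -> (i < j)%N by move=> js; apply: (lti (val j)); apply: map_f.
have pow V : \prod_(j <- i :: s | j \in V) t j
    = t i ^+ (i \in V) * \prod_(j <- s | j \in V) t j.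
  by rewrite big_cons; case: (i \in V); rewrite ?expr1 ?expr0 ?mul1r.
rewrite !pow -[LHS]mulrA [X in _ * X]mulrA anti_move -!mulrA.
rewrite [LHS]mulrA commr_sign -!mulrA IH.
have -> : (\sum_(a <- i :: s) \sum_(j <- i :: s) [&& a \in T, j \in U & j < a])%N
  = ((i \in U) * count [in T] s +
     \sum_(a <- s) \sum_(j <- s) [&& a \in T, j \in U & (j < a)%N])%N.
  rewrite big_cons [X in (X + _)%N]big1_seq ?add0n; last first.
    move=> j /= /[!inE] /predU1P[->|js]; first by rewrite ltnn !andbF.
    by rewrite ltnNge (ltnW (lt_i _ js)) !andbF.
  under eq_bigr do rewrite big_cons.
  rewrite big_split /=; congr (_ + _)%N; rewrite -sum1_count big_distrr /= [RHS]big_mkcond /=.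
  rewrite !big_seq; apply: eq_bigr => j js; rewrite (lt_i _ js) andbT.
  by case: (j \in T); case: (i \in U).
rewrite !inE; case: (i \in T); case: (i \in U) => /=.
- by rewrite !expr1 [X in _ * X]mulrA t_sqr0 mul0r mulr0.
all: case: ifP => _; rewrite ?mulr0 // ?mul0n ?expr0 ?expr1 ?mul1r //.
  by rewrite add0n [LHS]mulrA commr_sign -[LHS]mulrA.
rewrite mul1n exprD -[RHS]mulrA; congr (_ * _).
by rewrite [LHS]mulrA commr_sign -[LHS]mulrA.
Qed.

Lemma anti_prodM T U :
  (\prod_(i in T) t i) * (\prod_(i in U) t i) =
  if [disjoint T & U] then (-1) ^+ inversions T U * \prod_(i in T :|: U) t i else 0.
Proof.
have enumE V : \prod_(i in V) t i = \prod_(i <- enum 'I_N | i \in V) t i.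
  by rewrite enumT /index_enum unlock.
rewrite !enumE anti_prod; last first.
  by rewrite val_enum_ord -sorted_pairwise ?iota_ltn_sorted //; apply: ltn_trans.
rewrite -setI_eq0; case: ifPn => [/hasP[i _ iTU]|/hasPn nTU].
  by case: eqP => // e; move: iTU; rewrite e !inE.
have -> : T :&: U == set0.
  by apply/eqP/setP=> i; rewrite [RHS]inE; apply/negbTE/nTU; rewrite mem_enum.
congr (_ ^+ _ * _); rewrite big_enum /inversions -sum1_card /=.
under eq_bigr do rewrite big_enum /=.
rewrite pair_big /= [RHS]big_mkcond /=.
by apply: eq_bigr => p _; rewrite inE; case: ifP.
Qed.

Variable iota : {rmorphism K -> A}.
Hypothesis iota_comm : forall c a, iota c * a = a * iota c.

Definition gr_eval x : A := \sum_S iota (x S) * \prod_(i in S) t i.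

Lemma gr_eval_additive : additive gr_eval.
Proof.
move=> x y; rewrite /gr_eval -sumrB; apply: eq_bigr => S _.
by rewrite grD grN rmorphB mulrBl.
Qed.

Lemma gr_eval_multiplicative : multiplicative gr_eval.
Proof.
split=> [x y|].
  rewrite /gr_eval mulr_suml.
  under eq_bigr do rewrite grM rmorph_sum mulr_suml.
  under [RHS]eq_bigr do rewrite mulr_sumr.
  rewrite (exchange_big_dep xpredT) //=; apply: eq_bigr => T _.
  rewrite (reindex_onto (fun U => T :|: U) (fun S => S :\: T)) /=; last first.
    by move=> S sTS; rewrite setDE setUIr (setUidPr sTS) setUCr setIT.
  rewrite big_mkcond; apply: eq_bigr => U _.
  rewrite mulrA -[_ * _ * iota _]mulrA -iota_comm mulrA -[RHS]mulrA anti_prodM.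
  have -> : (T \subset T :|: U) && ((T :|: U) :\: T == U) = [disjoint T & U].
    by rewrite subsetUl /= setDUl setDv set0U disjoint_sym; apply/eqP/setDidPl.
  case: ifPn => dTU; last by rewrite !mulr0.
  rewrite setDUl setDv set0U (setDidPl _); last by rewrite disjoint_sym.
  by rewrite !rmorphM rmorph_sign [RHS]mulrA commr_sign.
rewrite /gr_eval (bigD1 set0) //= [X in _ + X]big1 ?addr0.
  by rewrite gr1 eqxx rmorph1 big_set0 mul1r.
by move=> S /negPf nS; rewrite gr1 nS rmorph0 mul0r.
Qed.

Lemma gr_eval_gen i : gr_eval (gr_gen K i) = t i.
Proof.
rewrite /gr_eval (bigD1 [set i]) //= [X in _ + X]big1 ?addr0.
  by rewrite ffunE eqxx rmorph1 big_set1 mul1r.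
by move=> S /negPf nS; rewrite ffunE nS rmorph0 mul0r.
Qed.

Lemma gr_eval_scal c : gr_eval (gr_scal c) = iota c.
Proof.
rewrite /gr_eval (bigD1 set0) //= [X in _ + X]big1 ?addr0.
  by rewrite ffunE eqxx big_set0 !mulr1.
by move=> S /negPf nS; rewrite ffunE nS mulr0 rmorph0 mul0r.
Qed.

End Anticommuting.

Lemma gr_gen_homog (i : 'I_N) : gr_homog true (gr_gen K i).
Proof.
move=> S; rewrite ffunE; have [->|] := eqVneq S [set i]; first by rewrite cards1.
by rewrite eqxx.
Qed.

Lemma gr_gen_sqr0 (i : 'I_N) : gr_gen K i * gr_gen K i = 0.
Proof. by have := gr_monM [set i] [set i]; rewrite disjoints1 set11. Qed.

Lemma gr_gen_anti (i j : 'I_N) : gr_gen K i * gr_gen K j = - (gr_gen K j * gr_gen K i).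
Proof.
by rewrite (gr_supercomm (@gr_gen_homog i) (@gr_gen_homog j)) expr1 mulN1r.
Qed.

End Universal.

Lemma inversions_imset N N' (h : 'I_N -> 'I_N') (T U : {set 'I_N}) :
  {mono h : i j / (i < j)%N} -> injective h ->
  inversions (h @: T) (h @: U) = inversions T U.
Proof.
move=> h_mono h_inj; rewrite /inversions.
have hh_inj : injective (fun p : 'I_N * 'I_N => (h p.1, h p.2)).
  by move=> [a b] [c d] /= [/h_inj -> /h_inj ->].
rewrite -[RHS](card_imset _ hh_inj); apply: eq_card => -[i j].
rewrite !inE /=; apply/and3P/imsetP => [[/imsetP[a aT ->] /imsetP[b bU ->]] | [[a b]]].
  by rewrite h_mono => lt_ba; exists (a, b); rewrite ?inE ?aT ?bU.
by rewrite inE /= => /and3P[aT bU lt_ba] [-> ->]; rewrite h_mono !imset_f.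
Qed.

Section Generators.
Variables (K : comNzRingType).

Lemma gr_mon_imset N N' (h : 'I_N -> 'I_N') (T : {set 'I_N}) :
  {mono h : i j / (i < j)%N} -> injective h ->
  gr_mon K (h @: T) = \prod_(i in T) gr_gen K (h i).
Proof.
move=> h_mono h_inj.
move: {2}#|T| (erefl #|T|) => k; elim: k T => [|k IH] T.
  by move/cards0_eq->; rewrite imset0 big_set0.
move=> cT; have /card_gt0P[i iT] : (0 < #|T|)%N by rewrite cT.
have cT' : #|T :\ i| = k by apply: succn_inj; rewrite -cT (cardsD1 i T) iT.
have dT' : [disjoint [set i] & T :\ i] by rewrite disjoints1 !inE eqxx.
have := gr_monM K (h @: [set i]) (h @: (T :\ i)).
rewrite (imset_disjoint h_inj).
rewrite dT' -imsetU setD1K // (IH _ cT') inversions_imset //.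
have -> : gr_mon K (h @: [set i]) = \prod_(j in [set i]) gr_gen K (h j).
  by rewrite big_set1 imset_set1.
rewrite (anti_prodM (fun i j => gr_gen_anti K (h i) (h j)) (fun i => gr_gen_sqr0 K (h i))).
rewrite dT' setD1K //.
by move/(congr1 (fun x => (-1) ^+ inversions [set i] (T :\ i) * x)); rewrite !signrMK.
Qed.

Variable N : nat.
Notation L := (grassmann K N).

Lemma gr_rmorph_ext (A : nzRingType) (f g : {rmorphism L -> A}) :
  (forall c, f (gr_scal N c) = g (gr_scal N c)) ->
  (forall i, f (gr_gen K i) = g (gr_gen K i)) -> f =1 g.
Proof.
move=> eq_scal eq_gen x; rewrite (gr_monE x) !rmorph_sum; apply: eq_bigr => T _.
rewrite !rmorphM eq_scal -[T]imset_id gr_mon_imset // !rmorph_prod; congr (_ * _).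
by apply: eq_bigr => i _; apply: eq_gen.
Qed.

(** The morphism maps theta_S to the ordered product of the t_i for i in S; it
    is multiplicative because the products of the t_i follow the sign rule of
    the monomials (anti_prodM). *)
Lemma gr_universal (A : nzRingType) (iota : {rmorphism K -> A}) (t : 'I_N -> A) :
  (forall c a, iota c * a = a * iota c) ->
  (forall i j, t i * t j = - (t j * t i)) -> (forall i, t i * t i = 0) ->
  exists f : {rmorphism L -> A},
    (forall c, f (gr_scal N c) = iota c) /\ (forall i, f (gr_gen K i) = t i).
Proof.
move=> iotaC t_anti t_sqr0.
pose add := GRing.isAdditive.Build L A (gr_eval t iota) (gr_eval_additive t iota).
pose mul := GRing.isMultiplicative.Build L A (gr_eval t iota)
  (gr_eval_multiplicative t_anti t_sqr0 iotaC).
pose f : {rmorphism L -> A} := HB.pack (gr_eval t iota) add mul.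
by exists f; split=> [c|i]; [apply: gr_eval_scal|apply: gr_eval_gen].
Qed.

End Generators.

(** * The commutative ring of even elements *)

Section EvenSubring.
Variables (K : comNzRingType) (N : nat).
Notation L := (grassmann K N).

Definition gr_even : {pred L} :=
  fun x => [forall S : {set 'I_N}, (x S != 0) ==> ~~ odd #|S|].

Lemma gr_evenP x : reflect (gr_homog false x) (x \in gr_even).
Proof.
apply: (iffP forallP) => hx S; last by apply/implyP=> /hx->.
by move/(implyP (hx S))/negbTE.
Qed.

Lemma gr_homogV (x : L) : gr_homog false x -> gr_homog false x^-1.
Proof.
move=> hx; have [ux|/invr_out-> //] := boolP (x \is a GRing.unit).
have := gr_partM false x^-1 hx; rewrite divrr // gr_part_id; last exact: gr_homog1.
move/(congr1 ( *%R x^-1)); rewrite mulrA mulVr // mul1r mulr1 => ->.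
exact: gr_part_homog.
Qed.

Lemma gr_even_subring : subring_closed gr_even.
Proof.
split=> [|x y /gr_evenP hx /gr_evenP hy|x y /gr_evenP hx /gr_evenP hy]; apply/gr_evenP.
- exact: gr_homog1.
- by apply: gr_homogD => //; apply: gr_homogN.
- exact: (gr_homogM hx hy).
Qed.

Lemma gr_even_divring : divring_closed gr_even.
Proof.
case: gr_even_subring => e1 eB eM; split=> // x y ex ey; apply: eM => //.
by apply/gr_evenP/gr_homogV/gr_evenP.
Qed.

HB.instance Definition _ := GRing.isDivringClosed.Build L gr_even gr_even_divring.

(** The even elements commute with each other, so that the theory of
    determinants over commutative rings applies to matrices with even entries. *)
Record even_gr := EvenGr { even_val :> L; _ : even_val \in gr_even }.
HB.instance Definition _ := [isSub for even_val].
HB.instance Definition _ := [Choice of even_gr by <:].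
HB.instance Definition _ := [SubChoice_isSubNzRing of even_gr by <:].

Lemma even_gr_homog (u : even_gr) : gr_homog false (val u).
Proof. exact/gr_evenP/(valP u). Qed.

Lemma even_gr_mulC : @commutative even_gr even_gr *%R.
Proof. by move=> u v; apply: val_inj; rewrite !rmorphM; apply/gr_even_comm/even_gr_homog. Qed.

HB.instance Definition _ :=
  GRing.PzRing_hasCommutativeMul.Build even_gr even_gr_mulC.
HB.instance Definition _ := [SubNzRing_isSubUnitRing of even_gr by <:].

Lemma even_gr_unit (u : even_gr) : val u \is a GRing.unit -> u \is a GRing.unit.
Proof. by []. Qed.

End EvenSubring.

(** * Matrices with even entries *)

Section EvenMatrices.
Variables (K : numFieldType) (N : nat).
Notation L := (grassmann K N).

Definition mx_homog (p : bool) a b (A : 'M[L]_(a, b)) : Prop :=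
  forall i j, gr_homog p (A i j).

Lemma mx_homogM p q a b c (A : 'M[L]_(a, b)) (B : 'M[L]_(b, c)) :
  mx_homog p A -> mx_homog q B -> mx_homog (p (+) q) (A *m B).
Proof.
by move=> hA hB i j; rewrite mxE; apply: gr_homog_sum => k _; apply: gr_homogM.
Qed.

Lemma mx_homogB p a b (A B : 'M[L]_(a, b)) :
  mx_homog p A -> mx_homog p B -> mx_homog p (A - B).
Proof.
by move=> hA hB i j; rewrite !mxE; apply: gr_homogD => //; apply: gr_homogN.
Qed.

Lemma mx_homog1 a : mx_homog false (1%:M : 'M[L]_a).
Proof. by move=> i j; rewrite mxE; case: eqP => _; [apply: gr_homog1|apply: gr_homog0]. Qed.

Lemma mx_even_lift a b (A : 'M[L]_(a, b)) : mx_homog false A ->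
  exists B : 'M[even_gr K N]_(a, b), A = map_mx val B.
Proof.
move=> hA; exists (\matrix_(i, j) EvenGr (introT (gr_evenP _) (hA i j))).
by apply/matrixP=> i j; rewrite !mxE.
Qed.

Lemma det_even_homog a (A : 'M[L]_a) : mx_homog false A -> gr_homog false (\det A).
Proof. by case/mx_even_lift=> B ->; rewrite det_map_mx; apply: even_gr_homog. Qed.

Lemma det_even_mulmx a (A B : 'M[L]_a) : mx_homog false A -> mx_homog false B ->
  \det (A *m B) = \det A * \det B.
Proof.
case/mx_even_lift=> A' -> /mx_even_lift[B' ->].
by rewrite -map_mxM !det_map_mx det_mulmx rmorphM.
Qed.

Lemma det_even_diag a (d : 'rV[L]_a) : mx_homog false d ->
  \det (diag_mx d) = \prod_i d 0 i.
Proof.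
case/mx_even_lift=> d' ->; rewrite -map_diag_mx det_map_mx det_diag rmorph_prod.
by apply: eq_bigr => i _; rewrite mxE.
Qed.

(** Without body, each factor contributes at least one generator. *)
Lemma gr_nilpotent (x : L) k (S : {set 'I_N}) :
  body x = 0 -> (#|S| < k)%N -> (x ^+ k) S = 0.
Proof.
move=> x0; elim: k S => // k IH S; rewrite ltnS => Sk; rewrite exprS grM.
apply: big1 => T sTS; have [->|nT] := eqVneq T set0.
  by rewrite [x set0]x0 mul0r mulr0.
rewrite IH ?mulr0 //; apply: leq_trans Sk.
rewrite -(cardsID T S) (setIidPr sTS) -[X in (X < _)%N]add0n ltn_add2r.
by rewrite card_gt0.
Qed.

(** After division by its body, x has the form 1 - y with y nilpotent, and
    the geometric series of y is a finite sum. *)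
Lemma gr_unit_body (x : L) : (x \is a GRing.unit) = (body x != 0).
Proof.
apply/idP/idP => [ux|x0]; first by rewrite -unitfE (rmorph_unit (@body K N)).
pose b := gr_scal N (body x)^-1; have bV : b * gr_scal N (body x) = 1.
  by rewrite -rmorphM mulVf ?rmorph1.
have bC y : b * y = y * b by apply/gr_even_comm/gr_scal_homog.
pose y := 1 - b * x; pose s := \sum_(i < N.+1) y ^+ i.
have y0 : body y = 0.
  by rewrite rmorphB rmorph1 rmorphM /= {1}/body ffunE eqxx mulr1 mulVf ?subrr.
have yN : y ^+ N.+1 = 0.
  by apply/ffunP=> S; rewrite gr0 gr_nilpotent // ltnS -[N in (_ <= N)%N]card_ord max_card.
have ys : b * x * s = 1.
  have := subrX1 y N.+1; rewrite yN add0r -/s => /(congr1 -%R).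
  by rewrite opprK -mulNr opprB /y opprB addrC subrK => <-.
have ysC : s * (b * x) = b * x * s.
  apply/commr_sym/commr_sum => i _; apply: commrX.
  by apply: commrB; [apply: commr1|].
apply/unitrP; exists (s * b); split; first by rewrite -mulrA ysC.
by rewrite -bC mulrA -bC.
Qed.

Lemma gr_odd_sqr0 (x : L) : gr_homog true x -> x * x = 0.
Proof.
move=> hx; have /ffunP e := gr_supercomm hx hx; apply/ffunP=> S; apply/eqP.
have /eqP := e S; rewrite expr1 mulN1r grN gr0 -addr_eq0 -mulr2n mulrn_eq0.
by [].
Qed.

Lemma body_odd (x : L) : gr_homog true x -> body x = 0.
Proof.
by move=> hx; apply/eqP; apply: contraTT isT => /hx; rewrite cards0.
Qed.

Lemma body_mx_odd a b (A : 'M[L]_(a, b)) : mx_homog true A -> map_mx (@body K N) A = 0.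
Proof. by move=> hA; apply/matrixP=> i j; rewrite !mxE body_odd. Qed.

Lemma mx_even_inv a (A : 'M[L]_a) :
  mx_homog false A -> \det (map_mx (@body K N) A) != 0 ->
  exists B, [/\ mx_homog false B, A *m B = 1%:M & B *m A = 1%:M].
Proof.
case/mx_even_lift=> B -> dB.
have uB : B \in unitmx.
  by rewrite unitmxE; apply: even_gr_unit; rewrite gr_unit_body -!det_map_mx.
exists (map_mx val (invmx B)); split; first by move=> i j; rewrite mxE; apply: even_gr_homog.
  by rewrite -map_mxM mulmxV // map_mx1.
by rewrite -map_mxM mulVmx // map_mx1.
Qed.

End EvenMatrices.

(** * The Berezinian of a diagonalizable matrix *)

(** Both sides are the determinant of the block matrix [[1, w], [v, 1]],
    computed with either Schur complement. *)
Lemma det_sub_rank1 (C : comNzRingType) a (v : 'cV[C]_a) (w : 'rV[C]_a) :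
  \det (1%:M - v *m w) = 1 - (w *m v) 0 0.
Proof.
pose B : 'M[C]_(1 + a) := block_mx 1%:M w v 1%:M.
have dB1 : \det B = \det (1%:M - v *m w).
  have -> : B = block_mx 1%:M 0 v 1%:M *m block_mx 1%:M w 0 (1%:M - v *m w).
    by rewrite mulmx_block !mul1mx !mulmx1 ?mul0mx ?mulmx0 ?addr0 subrKC.
  by rewrite det_mulmx det_lblock det_ublock !det1 !mul1r.
have dB2 : \det B = 1 - (w *m v) 0 0.
  have -> : B = block_mx (1%:M - w *m v) w 0 1%:M *m block_mx 1%:M 0 v 1%:M.
    by rewrite mulmx_block !mul1mx !mulmx1 ?mul0mx ?mulmx0 ?add0r subrK.
  by rewrite det_mulmx det_lblock det_ublock !det1 !mulr1 det_mx11 !mxE.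
by rewrite -dB1.
Qed.

Section Berezinian.
Variables (K : numFieldType) (N : nat).
Notation L := (grassmann K N).

Lemma det_even_sub_rank1 a (v : 'cV[L]_a) (w : 'rV[L]_a) :
  mx_homog false v -> mx_homog false w ->
  \det (1%:M - v *m w) = 1 - (w *m v) 0 0.
Proof.
case/mx_even_lift=> v' -> /mx_even_lift[w' ->].
rewrite -(map_mx1 (val : {rmorphism even_gr K N -> L})) -!map_mxM -map_mxB det_map_mx.
by rewrite det_sub_rank1 rmorphB rmorph1 [in RHS]mxE.
Qed.

Lemma det_gr1 a : \det (1%:M : 'M[L]_a) = 1.
Proof.
by rewrite -(map_mx1 (val : {rmorphism even_gr K N -> L})) det_map_mx det1 rmorph1.
Qed.

Lemma mx_homog_delta a b (i : 'I_a) (j : 'I_b) :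
  mx_homog false (delta_mx i j : 'M[L]_(a, b)).
Proof. by move=> k l; rewrite mxE; case: (_ && _); [apply: gr_homog1|apply: gr_homog0]. Qed.

Lemma body_sub1_odd a b (k : 'M[L]_(a, b)) (g : 'M[L]_(b, a)) :
  mx_homog true k -> map_mx (@body K N) (1%:M - k *m g) = 1%:M.
Proof.
by move=> hk; rewrite map_mxB map_mx1 map_mxM (body_mx_odd hk) mul0mx subr0.
Qed.

Lemma mx_homogZ p q a b (c : L) (A : 'M[L]_(a, b)) :
  gr_homog p c -> mx_homog q A -> mx_homog (p (+) q) (c *: A).
Proof. by move=> hc hA i j; rewrite mxE; apply: gr_homogM. Qed.

(** For even matrices the two determinants would be equal; for odd ones the
    traces of (kg)^j and (gk)^j are opposite, which inverts one determinant.
    The proof adds the entries c of g one at a time. Each is a perturbation of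
    rank one, which multiplies the first determinant by 1 - beta c and the second
    by 1 - c beta, for the same odd beta; the product of these two factors is
    (1 + c beta) (1 - c beta) = 1, because c and beta have square zero. *)
Lemma det_odd_mulC a b (k : 'M[L]_(a, b)) (g : 'M[L]_(b, a)) :
  mx_homog true k -> mx_homog true g ->
  \det (1%:M - k *m g) * \det (1%:M - g *m k) = 1.
Proof.
move=> hk hg; rewrite (matrix_sum_delta g) pair_big /=.
pose good h := mx_homog true h /\ \det (1%:M - k *m h) * \det (1%:M - h *m k) = 1.
suff [] : good (\sum_p g p.1 p.2 *: delta_mx p.1 p.2) by [].
elim/big_rec: _ => [|[i j] h _ [hh IH]] /=.
  split; first by move=> i j; rewrite mxE; apply: gr_homog0.
  by rewrite mulmx0 mul0mx !subr0 !det_gr1 mulr1.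
set c := g i j; have hc : gr_homog true c := hg i j.
pose ei : 'cV[L]_b := delta_mx i 0; pose ej : 'rV[L]_a := delta_mx 0 j.
have eE : delta_mx i j = ei *m ej by rewrite mul_delta_mx.
have hei : mx_homog false ei by apply: mx_homog_delta.
have hej : mx_homog false ej by apply: mx_homog_delta.
have hce : mx_homog true (c *: delta_mx i j).
  exact: (mx_homogZ hc (@mx_homog_delta _ _ i j)).
split; first by move=> s t; rewrite mxE; apply: gr_homogD.
have hM : mx_homog false (1%:M - k *m h).
  by apply: mx_homogB; [apply: mx_homog1|apply: (mx_homogM hk hh)].
have hM' : mx_homog false (1%:M - h *m k).
  by apply: mx_homogB; [apply: mx_homog1|apply: (mx_homogM hh hk)].
have [] := mx_even_inv hM; first by rewrite body_sub1_odd // det1 oner_eq0.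
move=> V [hV MV VM].
have [] := mx_even_inv hM'; first by rewrite body_sub1_odd // det1 oner_eq0.
move=> V' [hV' MV' VM'].
have hVk : mx_homog true (V *m k) by apply: (mx_homogM hV hk).
have swap : V *m k = k *m V'.
  rewrite -[LHS]mulmx1 -MV' mulmxA; congr (_ *m _); rewrite -mulmxA.
  rewrite (_ : k *m (1%:M - h *m k) = (1%:M - k *m h) *m k).
    by rewrite mulmxA VM mul1mx.
  by rewrite mulmxBr mulmxBl mulmx1 mul1mx mulmxA.
have hcei : mx_homog true (c *: ei) by apply: (mx_homogZ hc hei).
pose beta := (V *m k) j i; have hbeta : gr_homog true beta by apply: hVk.
have d1 : \det (1%:M - k *m (c *: delta_mx i j + h)) = \det (1%:M - k *m h) * (1 - beta * c).
  have -> : 1%:M - k *m (c *: delta_mx i j + h)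
      = (1%:M - k *m h) *m (1%:M - (V *m k *m (c *: ei)) *m ej).
    rewrite mulmxBr mulmx1 -!mulmxA [_ *m (V *m _)]mulmxA MV mul1mx -scalemxAl -eE.
    by rewrite mulmxDr opprD addrA addrAC.
  have hv : mx_homog false (V *m k *m (c *: ei)) by apply: (mx_homogM hVk hcei).
  rewrite det_even_mulmx //; last first.
    by apply: mx_homogB; [apply: mx_homog1|apply: (mx_homogM hv hej)].
  rewrite det_even_sub_rank1 // -rowE; congr (_ * (_ - _)).
  rewrite [LHS]mxE [LHS]mxE (bigD1 i) //= [X in _ + X]big1 ?addr0.
    by rewrite [(c *: ei) _ _]mxE [ei _ _]mxE !eqxx mulr1.
  by move=> s /negPf ns; rewrite [(c *: ei) _ _]mxE [ei _ _]mxE ns !mulr0.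
have d2 : \det (1%:M - (c *: delta_mx i j + h) *m k)
    = (1 - c * beta) * \det (1%:M - h *m k).
  pose w := c *: (ej *m (k *m V')).
  have hw : mx_homog false w.
    have hkV : mx_homog true (k *m V') by rewrite -swap.
    exact: (mx_homogZ hc (mx_homogM hej hkV)).
  have -> : 1%:M - (c *: delta_mx i j + h) *m k
      = (1%:M - ei *m w) *m (1%:M - h *m k).
    rewrite mulmxBl mul1mx -!mulmxA -scalemxAl -!mulmxA VM' mulmx1.
    rewrite [in RHS](_ : ei *m (c *: _) = c *: delta_mx i j *m k); last first.
      apply/matrixP=> s t; rewrite eE -scalemxAl -mulmxA !mxE !big_ord1 !mxE.
      by case: (_ && _); rewrite ?mul1r // !mul0r mulr0.
    by rewrite mulmxDl opprD addrA addrAC.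
  rewrite det_even_mulmx //; last first.
    by apply: mx_homogB; [apply: mx_homog1|apply: (mx_homogM hei hw)].
  rewrite det_even_sub_rank1 // /w -swap; congr ((_ - _) * _).
  rewrite -scalemxAl [LHS]mxE -mulmxA -rowE [X in c * X]mxE -/ei; congr (_ * _).
  by rewrite -colE mxE.
rewrite d1 d2 mulrA -[X in X * _]mulrA.
have -> : (1 - beta * c) * (1 - c * beta) = 1.
  have -> : beta * c = - (c * beta).
    by rewrite (gr_supercomm hbeta hc) expr1 mulN1r.
  rewrite opprK mulrBr mulr1 mulrDl mul1r opprD addrA addrK.
  rewrite (_ : c * beta * (c * beta) = 0) ?subr0 //.
  rewrite -mulrA [beta * _]mulrA (gr_supercomm hbeta hc) expr1 mulN1r mulNr.
  by rewrite -[c * beta * _]mulrA gr_odd_sqr0 // !mulr0 oppr0 mulr0.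
by rewrite mulr1.
Qed.
End Berezinian.

Section BerezinianEigen.
Variables (K : numFieldType) (N : nat).
Notation L := (grassmann K N).

Lemma inverse_unique (R : pzRingType) (x y : R) :
  x * y = 1 -> y * x = 1 -> inverse x = y.
Proof.
move=> xy yx; have [Vx _] : inverse x * x = 1 /\ x * inverse x = 1.
  by apply: inverseP; exists y.
by rewrite -[LHS]mulr1 -xy mulrA Vx mul1r.
Qed.

Lemma sparity_lshift n m (i : 'I_n) : sparity (lshift m i) = false.
Proof. by rewrite /sparity /= leqNgt ltn_ord. Qed.

Lemma sparity_rshift n m (i : 'I_m) : sparity (rshift n i) = true.
Proof. by rewrite /sparity /= leq_addr. Qed.

Lemma smx_even_block n m (A : 'M[L]_(n + m)) : smx_even A ->
  [/\ mx_homog false (ulsubmx A), mx_homog true (ursubmx A),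
      mx_homog true (dlsubmx A) & mx_homog false (drsubmx A)].
Proof.
move=> hA.
have sE := (sparity_lshift, sparity_rshift).
split=> i j; rewrite !mxE.
- by have := hA (lshift m i) (lshift m j); rewrite !sE.
- by have := hA (lshift m i) (rshift n j); rewrite !sE.
- by have := hA (rshift n i) (lshift m j); rewrite !sE.
- by have := hA (rshift n i) (rshift n j); rewrite !sE.
Qed.

Lemma mx_homog_diag a (d : 'rV[L]_a) : mx_homog false d -> mx_homog false (diag_mx d).
Proof.
by move=> hd i j; rewrite mxE; case: eqP => _; rewrite ?mulr1n ?mulr0n //; apply: gr_homog0.
Qed.

(** Put k = b d^-1 and g = r p^-1. Block elimination in the four equations
    that say that the columns of [[p, q], [r, s]] are eigenvectors gives
      (a - k c) p = (1 - k g) p D1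
    and
      (1 - g k) d (s - g q) = (s - g q) D2.
    Hence det (a - k c) = det (1 - k g) det D1 and det d = det D2 / det (1 - g k),
    and the two odd factors cancel in the quotient by det_odd_mulC. *)
Lemma schur_eigen n m (a p : 'M[L]_n) (b q : 'M[L]_(n, m)) (c r : 'M[L]_(m, n))
    (d s : 'M[L]_m) (d1 : 'rV[L]_n) (d2 : 'rV[L]_m) :
  mx_homog false a -> mx_homog true b -> mx_homog true c -> mx_homog false d ->
  mx_homog false p -> mx_homog true q -> mx_homog true r -> mx_homog false s ->
  \det (map_mx (@body K N) p) != 0 -> \det (map_mx (@body K N) s) != 0 ->
  mx_homog false d1 -> mx_homog false d2 -> (forall j, body (d2 0 j) != 0) ->
  a *m p + b *m r = p *m diag_mx d1 -> a *m q + b *m s = q *m diag_mx d2 ->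
  c *m p + d *m r = r *m diag_mx d1 -> c *m q + d *m s = s *m diag_mx d2 ->
  \det (a - b *m inverse d *m c) / \det d = (\prod_i d1 0 i) / \prod_j d2 0 j.
Proof.
move=> ha hb hc hd hp hq hr hs dp ds hd1 hd2 d2nz.
rewrite -!det_even_diag //; move: (diag_mx d1) (mx_homog_diag hd1) => D1 hD1.
have dD2 : \det (map_mx (@body K N) (diag_mx d2)) != 0.
  rewrite map_diag_mx det_diag prodf_seq_neq0; apply/allP=> j _ /=.
  by rewrite mxE d2nz.
move: (diag_mx d2) (mx_homog_diag hd2) dD2 => D2 hD2 dD2 E1 E3 E2 E4.
pose bd a' b' := @map_mx _ _ (@body K N) a' b'.
have ds2 : bd _ _ d *m bd _ _ s = bd _ _ s *m bd _ _ D2.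
  move: E4 => /(congr1 (bd _ _)); rewrite /bd map_mxD !map_mxM (body_mx_odd hc).
  by rewrite mul0mx add0r.
have dd : \det (bd _ _ d) != 0.
  move: ds2 => /(congr1 determinant); rewrite !det_mulmx => e.
  by apply: contraTneq (mulf_neq0 ds dD2) => z; rewrite -e z mul0r eqxx.
have [p' [hp' pp' p'p]] := mx_even_inv hp dp.
have [d' [hd' dd' d'd]] := mx_even_inv hd dd.
have -> : inverse d = d' by apply: inverse_unique.
pose k := b *m d'; pose g := r *m p'.
have hk : mx_homog true k := mx_homogM hb hd'.
have hg : mx_homog true g := mx_homogM hr hp'.
have gp : g *m p = r by rewrite -mulmxA p'p mulmx1.
have kd : k *m d = b by rewrite -mulmxA d'd mulmx1.
rewrite -/k; clearbody k g.
have key := det_odd_mulC hk hg.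
have h1kg : mx_homog false (1%:M - k *m g).
  by apply: mx_homogB; [apply: mx_homog1|apply: (mx_homogM hk hg)].
have h1gk : mx_homog false (1%:M - g *m k).
  by apply: mx_homogB; [apply: mx_homog1|apply: (mx_homogM hg hk)].
have hsig : mx_homog false (a - k *m c).
  by apply: mx_homogB => //; apply: (mx_homogM hk hc).
have hsq : mx_homog false (s - g *m q).
  by apply: mx_homogB => //; apply: (mx_homogM hg hq).
have sig : (a - k *m c) *m p = (1%:M - k *m g) *m p *m D1.
  have -> : (1%:M - k *m g) *m p = p - k *m r.
    by rewrite mulmxBl mul1mx -mulmxA gp.
  rewrite !mulmxBl -E1 -[k *m r *m _]mulmxA -E2 mulmxDr opprD [k *m (d *m r)]mulmxA.
  by rewrite kd addrACA subrr addr0 mulmxA.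
have del : (1%:M - g *m k) *m d *m (s - g *m q) = (s - g *m q) *m D2.
  have -> : (1%:M - g *m k) *m d = d - g *m b.
    by rewrite mulmxBl mul1mx -mulmxA kd.
  have ap : a *m p = p *m D1 - b *m r by rewrite -E1 addrK.
  have cp : c *m p = r *m D1 - d *m r by rewrite -E2 addrK.
  have bs : b *m s = q *m D2 - a *m q by rewrite -E3 addrC addKr.
  have ds' : d *m s = s *m D2 - c *m q by rewrite -E4 addrC addKr.
  (* With X = d - g b, the terms in g a - c cancel in X s - X g q. *)
  have cancel_p (X Y : 'M_(m, n)) : X *m p = Y *m p -> X = Y.
    by move/(congr1 (mulmx^~ p')); rewrite -!mulmxA pp' !mulmx1.
  have Xg : (d - g *m b) *m g = g *m a - c.
    apply: cancel_p; rewrite -[LHS]mulmxA gp !mulmxBl -mulmxA cp.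
    rewrite -[g *m a *m p]mulmxA ap mulmxBr.
    by rewrite [g *m (p *m _)]mulmxA gp opprB [RHS]addrC addrA subrK.
  have Xs : (d - g *m b) *m s = (s - g *m q) *m D2 + (g *m a - c) *m q.
    rewrite !mulmxBl ds' -!mulmxA bs mulmxBr opprB.
    by rewrite addrACA [RHS]addrACA [- (c *m q) + _]addrC.
  by rewrite mulmxBr Xs mulmxA Xg addrK.
have hd1k : mx_homog false ((1%:M - g *m k) *m d) by apply: (mx_homogM h1gk hd).
have dsq : \det (s - g *m q) \is a GRing.unit.
  rewrite gr_unit_body -det_map_mx map_mxB map_mxM (body_mx_odd hg) mul0mx subr0.
  exact: ds.
have dpu : \det p \is a GRing.unit by rewrite gr_unit_body -det_map_mx.
have ddu : \det d \is a GRing.unit by rewrite gr_unit_body -det_map_mx.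
have detsig : \det (a - k *m c) = \det (1%:M - k *m g) * \det D1.
  apply: (mulIr dpu); rewrite -[LHS]det_even_mulmx // sig det_even_mulmx //; last first.
    exact: (mx_homogM h1kg hp).
  rewrite det_even_mulmx // -[LHS]mulrA [\det p * _]gr_even_comm ?mulrA //.
  exact: det_even_homog.
have detD2 : \det (1%:M - g *m k) * \det d = \det D2.
  apply: (mulIr dsq); rewrite -!det_even_mulmx // del det_even_mulmx //.
  by rewrite det_even_mulmx //; apply: gr_even_comm; apply: det_even_homog.
rewrite detsig -detD2.
have u1 : \det (1%:M - g *m k) \is a GRing.unit.
  by rewrite gr_unit_body -det_map_mx body_sub1_odd // det1 oner_eq0.
apply: (mulIr ddu); rewrite mulrVK // [\det (1%:M - k *m g) * _]gr_even_comm; last first.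
  exact: det_even_homog.
apply: (mulIr u1); rewrite -[LHS]mulrA key mulr1 -[RHS]mulrA [\det d * _]gr_even_comm.
  by rewrite mulrVK // unitrMl.
exact: det_even_homog.
Qed.

Lemma Ber_eigen n m (M P Q : 'M[L]_(n + m)) (d1 : 'rV[L]_n) (d2 : 'rV[L]_m) :
  smx_even M -> smx_even P -> P *m Q = 1%:M ->
  mx_homog false d1 -> mx_homog false d2 -> (forall j, body (d2 0 j) != 0) ->
  M *m P = P *m block_mx (diag_mx d1) 0 0 (diag_mx d2) ->
  Ber M = (\prod_i d1 0 i) / \prod_j d2 0 j.
Proof.
move=> /smx_even_block[ha hb hc hd] /smx_even_block[hp hq hr hs] PQ hd1 hd2 d2nz.
rewrite -{1}(submxK M) -{1 2}(submxK P) !mulmx_block.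
rewrite !mulmx0 !addr0 !add0r => /eq_block_mx[E1 E2 E3 E4].
have /andP[dp ds] : (\det (map_mx (@body K N) (ulsubmx P)) != 0)
    && (\det (map_mx (@body K N) (drsubmx P)) != 0).
  rewrite -negb_or -mulf_eq0 -(det_ublock _ 0).
  rewrite -{1}(body_mx_odd hq) -(body_mx_odd hr) -map_block_mx submxK.
  have : map_mx (@body K N) P *m map_mx (@body K N) Q = 1%:M.
    by rewrite -map_mxM PQ map_mx1.
  by move/mulmx1_unit=> []; rewrite unitmxE unitfE.
exact: (schur_eigen ha hb hc hd hp hq hr hs dp ds hd1 hd2 d2nz E1 E2 E3 E4).
Qed.
End BerezinianEigen.

(** * The symmetric superalgebra *)

Section MPolyParity.
Variables (K : numFieldType) (N p : nat).
Notation G := (grassmann K N).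
Notation T := (mpoly p G).
Implicit Types (s t : T).

Definition mp_homog (b : bool) s : Prop := forall k, gr_homog b (mcoeff k s).

Lemma mp_homogD b s t : mp_homog b s -> mp_homog b t -> mp_homog b (s + t).
Proof. by move=> hs ht k; rewrite mcoeffD; apply: gr_homogD. Qed.

Lemma mp_homog0 b : mp_homog b 0.
Proof. by move=> k; rewrite mcoeff0; apply: gr_homog0. Qed.

Lemma mp_homogM b c s t : mp_homog b s -> mp_homog c t -> mp_homog (b (+) c) (s * t).
Proof.
by move=> hs ht k; rewrite mcoeffM; apply: gr_homog_sum => i _; apply: gr_homogM.
Qed.

Lemma mp_homogC b (c : G) : gr_homog b c -> mp_homog b (mpolyC p c).
Proof.
move=> hc k; rewrite mcoeffC; case: eqP => _; rewrite ?mulr1 ?mulr0 //.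
exact: gr_homog0.
Qed.

Lemma mp_homog1 : mp_homog false 1.
Proof. by apply: mp_homogC; apply: gr_homog1. Qed.

Lemma mp_homogX m : mp_homog false (mpolyX G m).
Proof.
by move=> k; rewrite mcoeffX; case: eqP => _; [apply: gr_homog1|apply: gr_homog0].
Qed.

Lemma mp_even_comm s t : mp_homog false s -> s * t = t * s.
Proof.
move=> hs; apply/mpolyP => k; rewrite mcoeffM mcoeffMr; apply: eq_bigr => i _.
exact: gr_even_comm.
Qed.

Lemma mp_odd_anti s t : mp_homog true s -> mp_homog true t -> s * t = - (t * s).
Proof.
move=> hs ht; apply/mpolyP => k; rewrite mcoeffN mcoeffM mcoeffMr -sumrN.
by apply: eq_bigr => i _; rewrite (gr_supercomm (hs _) (ht _)) expr1 mulN1r.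
Qed.

Lemma mp_odd_sqr0 s : mp_homog true s -> s * s = 0.
Proof.
move=> hs; have /mpolyP e := mp_odd_anti hs hs; apply/mpolyP => k.
apply/ffunP=> S; have /ffunP/(_ S)/eqP := e k.
by rewrite mcoeffN grN mcoeff0 gr0 -addr_eq0 -mulr2n mulrn_eq0 => /eqP.
Qed.

End MPolyParity.

Section SymmetricAlgebra.
Variables (K : numFieldType) (N p q : nat).
Notation L := (grassmann K N).
Notation G := (grassmann K (q + N)).
Notation T := (mpoly p G).

Lemma shift_setK (S : {set 'I_(q + N)}) :
  @lshift q N @: (@lshift q N @^-1: S) :|: @rshift q N @: (@rshift q N @^-1: S) = S.
Proof.
apply/setP=> i; rewrite inE; apply/orP/idP => [[]|iS].
- by case/imsetP=> j; rewrite inE => ? ->.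
- by case/imsetP=> j; rewrite inE => ? ->.
case: (splitP i) => j ij.
  have ei : i = lshift N j by apply: val_inj.
  by left; rewrite ei imset_f // inE -ei.
have ei : i = rshift q j by apply: val_inj.
by right; rewrite ei imset_f // inE -ei.
Qed.

Lemma lshift_preim (Q : {set 'I_q}) (U : {set 'I_N}) :
  @lshift q N @^-1: (@lshift q N @: Q :|: @rshift q N @: U) = Q.
Proof.
apply/setP=> i; rewrite !inE mem_imset; last exact: lshift_inj.
case: (i \in Q) => //=; apply/imsetP=> -[j _ /eqP]; by rewrite eq_lrshift.
Qed.

Lemma rshift_preim (Q : {set 'I_q}) (U : {set 'I_N}) :
  @rshift q N @^-1: (@lshift q N @: Q :|: @rshift q N @: U) = U.
Proof.
apply/setP=> i; rewrite !inE orbC mem_imset; last exact: rshift_inj.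
case: (i \in U) => //=; apply/imsetP=> -[j _ /eqP]; by rewrite eq_rlshift.
Qed.

Lemma card_shift (S : {set 'I_(q + N)}) :
  #|S| = (#|@lshift q N @^-1: S| + #|@rshift q N @^-1: S|)%N.
Proof.
rewrite -{1}[S]shift_setK cardsU [X in (_ - X)%N](_ : _ = 0%N); last first.
  apply: eq_card0 => i; rewrite !inE; apply/negP => /andP[/imsetP[j _ ->]].
  by case/imsetP=> k _ /eqP; rewrite eq_lrshift.
rewrite subn0 !card_imset //; [exact: rshift_inj | exact: lshift_inj].
Qed.

(** In this form, multiplicativity of the embedding is an instance of
    gr_eval_multiplicative. *)
Lemma gr_embedE (x : L) :
  gr_embed q x = gr_eval (fun j => gr_gen K (rshift q j)) (@gr_scal K (q + N)) x.
Proof.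
apply/ffunP=> S; rewrite /gr_eval gr_sum ffunE.
transitivity (\sum_(U : {set 'I_N}) x U * (S == @rshift q N @: U)%:R).
  case: ifPn => [/eqP S0|S0].
    rewrite (bigD1 (@rshift q N @^-1: S)) //= [X in _ + X]big1 ?addr0.
      by have := shift_setK S; rewrite S0 imset0 set0U => ->; rewrite eqxx mulr1.
    move=> U /negPf nU; case: eqP => [eS|]; last by rewrite mulr0.
    by move: nU; rewrite eS -[_ @: U]set0U -(imset0 (@lshift q N)) rshift_preim eqxx.
  rewrite big1 // => U _; case: eqP => [eS|]; last by rewrite mulr0.
  by move: S0; rewrite eS -[_ @: U]set0U -(imset0 (@lshift q N)) lshift_preim eqxx.
apply: eq_bigr => U _; rewrite gr_scalM -gr_mon_imset ?ffunE //.
  by move=> i j; rewrite /= ltn_add2l.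
exact: rshift_inj.
Qed.

Lemma scal_comm M c (a : grassmann K M) : gr_scal M c * a = a * gr_scal M c.
Proof. by apply: gr_even_comm; apply: gr_scal_homog. Qed.

Lemma gr_embed_additive : additive (@gr_embed K N q).
Proof. by move=> x y; rewrite !gr_embedE gr_eval_additive. Qed.

Lemma gr_embed_multiplicative : multiplicative (@gr_embed K N q).
Proof.
have [eM e1] := gr_eval_multiplicative
  (fun i j => gr_gen_anti K (@rshift q N i) (rshift q j))
  (fun i => gr_gen_sqr0 K (rshift q i)) (@scal_comm (q + N)).
by split=> [x y|]; rewrite !gr_embedE ?eM ?e1.
Qed.

HB.instance Definition _ :=
  GRing.isAdditive.Build L G (@gr_embed K N q) gr_embed_additive.
HB.instance Definition _ :=
  GRing.isMultiplicative.Build L G (@gr_embed K N q) gr_embed_multiplicative.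

Lemma gr_embed_scal (c : K) : gr_embed q (gr_scal N c) = gr_scal (q + N) c.
Proof. by rewrite gr_embedE gr_eval_scal. Qed.

Lemma gr_embed_gen (i : 'I_N) : gr_embed q (gr_gen K i) = gr_gen K (rshift q i).
Proof. by rewrite gr_embedE gr_eval_gen. Qed.

Lemma gr_embed_homog b (x : L) : gr_homog b x -> gr_homog b (gr_embed q x).
Proof.
move=> hx S; rewrite ffunE; case: ifPn => [/eqP S0 /hx <-|]; last by rewrite eqxx.
by rewrite card_shift S0 cards0.
Qed.

Definition gr_lmon (Q : {set 'I_q}) : G := gr_mon K (@lshift q N @: Q).

(** There is no sign because the generators xi precede the generators eta. *)
Lemma gr_lmon_embed Q (c : L) S : (gr_lmon Q * gr_embed q c) S =
  if @lshift q N @^-1: S == Q then c (@rshift q N @^-1: S) else 0.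
Proof.
rewrite gr_embedE /gr_eval mulr_sumr gr_sum.
transitivity (\sum_(U : {set 'I_N}) c U * (S == @lshift q N @: Q :|: @rshift q N @: U)%:R).
  apply: eq_bigr => U _; rewrite mulrA -scal_comm -mulrA gr_scalM; congr (_ * _).
  rewrite -gr_mon_imset; last first.
  - exact: rshift_inj.
  - by move=> i j; rewrite /= ltn_add2l.
  rewrite gr_monM ifT; last first.
    rewrite -setI_eq0; apply/eqP/setP=> i; rewrite !inE; apply/negP => /andP[/imsetP[j _ ->]].
    by case/imsetP=> k _ /eqP; rewrite eq_lrshift.
  rewrite [X in (-1) ^+ X](_ : _ = 0%N) ?mul1r ?ffunE //.
  apply: eq_card0 => -[i j]; rewrite !inE /=; apply/negP.
  by case/and3P=> /imsetP[a _ ->] /imsetP[b _ ->] /=; rewrite ltnNge ltnW // ltn_addr.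
case: eqP => [<-|nQ].
  rewrite (bigD1 (@rshift q N @^-1: S)) //= [X in _ + X]big1 ?addr0.
    by rewrite shift_setK eqxx mulr1.
  move=> U /negPf nU; case: eqP => [eS|]; last by rewrite mulr0.
  by move: nU; rewrite eS rshift_preim eqxx.
rewrite big1 // => U _; case: eqP => [eS|]; last by rewrite mulr0.
by case: nQ; rewrite eS lshift_preim.
Qed.

Lemma gr_coef_lmon Q Q' (c : L) :
  gr_coef Q (gr_lmon Q' * gr_embed q c) = c *+ (Q == Q').
Proof.
apply/ffunP=> U; rewrite ffunE gr_lmon_embed lshift_preim rshift_preim.
by case: eqP; rewrite ?gr0.
Qed.

Lemma gr_coefD Q (x y : G) : gr_coef Q (x + y) = gr_coef Q x + gr_coef Q y.
Proof. by apply/ffunP=> U; rewrite !ffunE. Qed.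

Lemma gr_coef0 Q : gr_coef Q (0 : G) = 0.
Proof. by apply/ffunP=> U; rewrite !ffunE. Qed.

Lemma gr_coef_sum (I : Type) (r : seq I) (P : pred I) (F : I -> G) Q :
  gr_coef Q (\sum_(i <- r | P i) F i) = \sum_(i <- r | P i) gr_coef Q (F i).
Proof.
by elim/big_rec2: _ => [|i a b _ <-]; rewrite ?gr_coef0 ?gr_coefD.
Qed.

Lemma gr_coefE (x : G) : x = \sum_Q gr_lmon Q * gr_embed q (gr_coef Q x).
Proof.
apply/ffunP=> S; rewrite gr_sum (bigD1 (@lshift q N @^-1: S)) //= big1 ?addr0.
  by rewrite gr_lmon_embed eqxx ffunE shift_setK.
by move=> Q /negPf nQ; rewrite gr_lmon_embed eq_sym nQ.
Qed.

Lemma gr_coefM Q (x : G) (c : L) : gr_coef Q (x * gr_embed q c) = gr_coef Q x * c.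
Proof.
rewrite {1}[x]gr_coefE mulr_suml gr_coef_sum (bigD1 Q) //= big1 ?addr0.
  by rewrite -mulrA -rmorphM gr_coef_lmon eqxx.
by move=> Q' /negPf nQ; rewrite -mulrA -rmorphM gr_coef_lmon eq_sym nQ.
Qed.

Lemma gr_coef_homog b (Q : {set 'I_q}) (x : G) :
  gr_homog b x -> gr_homog (odd #|Q| (+) b) (gr_coef Q x).
Proof.
move=> hx U; rewrite ffunE => /hx <-.
by rewrite card_shift lshift_preim rshift_preim oddD addbA addbb.
Qed.

End SymmetricAlgebra.

(** * Functoriality of symmetric powers *)

Section SymmetricFunctor.
Variables (K : numFieldType) (N p q : nat).
Notation L := (grassmann K N).
Notation G := (grassmann K (q + N)).
Notation T := (mpoly p G).
Implicit Types (s t : T).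

Lemma sym_gen_even mu : sym_gen K N (lshift q mu) = mpolyX G (mnm1 mu) :> T.
Proof. by rewrite /sym_gen -[lshift q mu]/(unsplit (inl mu)) unsplitK. Qed.

Lemma sym_gen_odd a : sym_gen K N (rshift p a) = mpolyC p (gr_gen K (lshift N a)) :> T.
Proof. by rewrite /sym_gen -[rshift p a]/(unsplit (inr a)) unsplitK. Qed.

(** The coefficients are evaluated by the universal property of the Grassmann
    algebra, and then the polynomial variables, whose images w are central since
    they are even. *)
Lemma sym_alg_universal (w : 'I_(p + q) -> T) :
  (forall mu, mp_homog false (w (lshift q mu))) ->
  (forall a, mp_homog true (w (rshift p a))) ->
  exists f : {rmorphism T -> T},
    (forall i, f (sym_gen K N i) = w i) /\
    (forall c : L, f (sym_embed p q c) = sym_embed p q c).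
Proof.
move=> w_even w_odd.
pose t (j : 'I_(q + N)) : T := match split j with
  | inl a => w (rshift p a)
  | inr i => mpolyC p (gr_gen K (rshift q i)) end.
have t_odd j : mp_homog true (t j).
  by rewrite /t; case: split => i //; apply: mp_homogC; apply: gr_gen_homog.
pose iota : {rmorphism K -> T} := @mpolyC p G \o gr_scal (q + N).
have iotaC c a : iota c * a = a * iota c.
  by apply: mp_even_comm; apply: mp_homogC; apply: gr_scal_homog.
have [f [f_scal f_gen]] := gr_universal iotaC
  (fun i j => mp_odd_anti (t_odd i) (t_odd j)) (fun i => mp_odd_sqr0 (t_odd i)).
pose h mu := w (lshift q mu).
have hC i x : GRing.comm x (h i) by apply/esym/mp_even_comm/w_even.
have Phi_mul : multiplicative (mmap f h).
  apply: commr_mmap_is_multiplicative => [|s m m']; first exact: hC.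
  rewrite /mmap1; apply: commr_prod => i _; exact/commrX/hC.
pose Phi : {rmorphism T -> T} := HB.pack (mmap f h)
  (GRing.isAdditive.Build T T (mmap f h) (mmap_is_additive h f))
  (GRing.isMultiplicative.Build T T (mmap f h) Phi_mul).
have PhiE s : Phi s = mmap f h s by [].
have f_embed : f \o gr_embed q =1 @mpolyC p G \o gr_embed q.
  apply: gr_rmorph_ext => [c|i] /=.
    by rewrite gr_embed_scal f_scal.
  by rewrite gr_embed_gen f_gen /t -[rshift q i]/(unsplit (inr i)) unsplitK.
exists Phi; split=> [i|c]; last first.
  by rewrite PhiE /sym_embed mmapC; apply: f_embed.
rewrite PhiE; case: (split_ordP i) => j ->.
  by rewrite sym_gen_even mmapX mmap1U.
by rewrite sym_gen_odd mmapC [LHS]f_gen /t -[lshift N j]/(unsplit (inl j)) unsplitK.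
Qed.

Definition sym_mon (k : multinom p) (Q : {set 'I_q}) : T :=
  mpolyC p (gr_lmon K N Q) * mpolyX G k.

Lemma sym_mon_prod (k : multinom p) (Q : {set 'I_q}) :
  (\prod_(a < q | a \in Q) sym_gen K N (rshift p a)) *
  (\prod_(mu < p) sym_gen K N (lshift q mu) ^+ k mu) = sym_mon k Q.
Proof.
congr (_ * _).
  under eq_bigr do rewrite sym_gen_odd.
  rewrite -rmorph_prod /gr_lmon gr_mon_imset //; exact: lshift_inj.
by under eq_bigr do rewrite sym_gen_even; rewrite mpolyXE_id.
Qed.

Lemma mcoeff_mulC s (c : G) k : mcoeff k (s * mpolyC p c) = mcoeff k s * c.
Proof.
rewrite {1}[s]mpolyE mulr_suml raddf_sum /= [in RHS](mpolyE s) [in RHS]raddf_sum /=.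
rewrite mulr_suml; apply: eq_bigr => m _.
rewrite -!mul_mpolyC -mulrA -(commr_mpolyX m (mpolyC p c)) mulrA -mpolyCM.
rewrite !mcoeffCM mcoeffX -!mulrA; congr (_ * _).
by case: eqP; rewrite ?mulr1 ?mul1r ?mulr0 ?mul0r.
Qed.

Variable r : nat.
Notation I := (sym_basis p q r).

Lemma sym_coefM (b : I) s c : sym_coef b (s * sym_embed p q c) = sym_coef b s * c.
Proof. by rewrite /sym_coef mcoeff_mulC gr_coefM. Qed.

Lemma sym_coef_sum (b : I) (J : Type) (e : seq J) (P : pred J) (F : J -> T) :
  sym_coef b (\sum_(i <- e | P i) F i) = \sum_(i <- e | P i) sym_coef b (F i).
Proof. by rewrite /sym_coef raddf_sum gr_coef_sum. Qed.

Lemma mcoeff_sym_mon k k' Q (c : L) :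
  mcoeff k (sym_mon k' Q * sym_embed p q c)
  = (gr_lmon K N Q * gr_embed q c) *+ (k' == k).
Proof.
rewrite mcoeff_mulC /sym_mon mcoeffCM mcoeffX.
by case: (k' == k); rewrite ?mulr1 // mulr0 mul0r.
Qed.

Lemma sym_coef_mon (b b' : I) (c : L) :
  sym_coef b (sym_mon (val b').1 (val b').2 * sym_embed p q c) = c *+ (b == b').
Proof.
rewrite /sym_coef mcoeff_sym_mon (_ : (b == b') = (val b == val b')) //.
case: (val b) => k Q; case: (val b') => k' Q' /=; rewrite xpair_eqE bmeqP eq_sym.
by case: eqP => _ /=; rewrite ?gr_coef0 // gr_coef_lmon.
Qed.

(** The degree in S(W): the xi have degree one, the eta degree zero. *)
Definition sym_deg d s : Prop :=
  forall k S, mcoeff k s S != 0 -> (mdeg k + #|@lshift q N @^-1: S|)%N = d.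

Lemma sym_deg0 d : sym_deg d 0.
Proof. by move=> k S; rewrite mcoeff0 gr0 eqxx. Qed.

Lemma sym_degD d s t : sym_deg d s -> sym_deg d t -> sym_deg d (s + t).
Proof.
move=> hs ht k S; rewrite mcoeffD grD; have [->|/hs //] := eqVneq (mcoeff k s S) 0.
by rewrite add0r; apply: ht.
Qed.

Lemma sym_degM d e s t : sym_deg d s -> sym_deg e t -> sym_deg (d + e) (s * t).
Proof.
move=> hs ht k S; rewrite mcoeffM gr_sum => /sum_neq0[[k1 k2] /= /eqP ek].
rewrite grM => /sum_neq0[U sUS nz].
have sU : mcoeff k1 s U != 0 by apply: contraNneq nz => ->; rewrite mul0r mulr0.
have tU : mcoeff k2 t (S :\: U) != 0 by apply: contraNneq nz => ->; rewrite !mulr0.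
have := congr1 (@mdeg p) ek; rewrite mdegD => ->.
rewrite -(hs _ _ sU) -(ht _ _ tU) -(cardsID (@lshift q N @^-1: U) (@lshift q N @^-1: S)).
by rewrite -preimsetI (setIidPr sUS) -preimsetD addnACA.
Qed.

Lemma sym_deg_embed c : sym_deg 0 (sym_embed p q c).
Proof.
move=> k S; rewrite mcoeffC; have [->|] := eqVneq k (@mnm0 p); last first.
  by rewrite mulr0 gr0 eqxx.
rewrite mulr1 mdeg0 ffunE; case: ifP => [/eqP ->|]; rewrite ?cards0 //.
by rewrite eqxx.
Qed.

Lemma sym_deg_gen i : sym_deg 1 (sym_gen K N i : T).
Proof.
case: (split_ordP i) => j -> k S.
  rewrite sym_gen_even mcoeffX; have [<-|] := eqVneq (mnm1 j) k; last by rewrite gr0 eqxx.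
  rewrite gr1; have [->|] := eqVneq S set0; last by rewrite eqxx.
  by rewrite mdeg1 preimset0 cards0.
rewrite sym_gen_odd mcoeffC; have [->|] := eqVneq k (@mnm0 p); last first.
  by rewrite mulr0 gr0 eqxx.
rewrite mulr1 ffunE; have [->|] := eqVneq S [set lshift N j]; last by rewrite eqxx.
rewrite mdeg0 (_ : _ @^-1: _ = [set j]) ?cards1 //.
by apply/setP=> i'; rewrite !inE eq_lshift.
Qed.

Lemma sym_deg1 : sym_deg 0 1.
Proof. by have := @sym_deg_embed 1; rewrite /sym_embed rmorph1. Qed.

Lemma sym_deg_prod (J : finType) (P : pred J) (F : J -> T) (d : J -> nat) :
  (forall i, P i -> sym_deg (d i) (F i)) ->
  sym_deg (\sum_(i | P i) d i) (\prod_(i | P i) F i).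
Proof.
move=> hF; elim/big_rec2: _ => [|i a b Pi]; first exact: sym_deg1.
by apply: sym_degM; apply: hF.
Qed.

Lemma sym_degX d s n : sym_deg d s -> sym_deg (n * d) (s ^+ n).
Proof.
move=> hs; elim: n => [|n IH]; first by rewrite expr0; apply: sym_deg1.
by rewrite exprS mulSn; apply: sym_degM.
Qed.

(** Homogeneity of s leaves only the basis vectors of S^r in its expansion. *)
Lemma sym_expand s : sym_deg r s ->
  s = \sum_(b : I) sym_mon (val b).1 (val b).2 * sym_embed p q (sym_coef b s).
Proof.
move=> hs; apply/mpolyP => k; apply/ffunP => S; rewrite raddf_sum gr_sum /=.
under eq_bigr do rewrite mcoeff_sym_mon.
have [s0|/hs deg_kS] := eqVneq (mcoeff k s S) 0.
  rewrite s0 big1 // => b _; case: eqP => [e|_]; last by rewrite mulr0n gr0.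
  rewrite mulr1n gr_lmon_embed; case: eqP => // eQ.
  by rewrite ffunE e -eQ shift_setK.
have ltk : (mdeg k < r.+1)%N by rewrite ltnS -deg_kS leq_addr.
have Pb : (mdeg (BMultinom ltk) + #|@lshift q N @^-1: S|)%N == r by apply/eqP.
pose b0 : I := exist _ (BMultinom ltk, @lshift q N @^-1: S) Pb.
rewrite (bigD1 b0) //= eqxx mulr1n gr_lmon_embed eqxx ffunE shift_setK.
rewrite big1 ?addr0 // => b nb; case: eqP => [e|_]; last by rewrite mulr0n gr0.
rewrite mulr1n gr_lmon_embed; case: eqP => // eQ.
case/eqP: nb; apply: val_inj; rewrite /= eQ [LHS]surjective_pairing.
by congr (_, _); apply: val_inj.
Qed.

Lemma mp_homog_embed b (c : L) : gr_homog b c -> mp_homog b (sym_embed p q c).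
Proof. by move=> hc; apply: mp_homogC; apply: gr_embed_homog. Qed.

Lemma mp_homog_gen (i : 'I_(p + q)) : mp_homog (sparity i) (sym_gen K N i : T).
Proof.
case: (split_ordP i) => j ->; rewrite ?sparity_lshift ?sparity_rshift.
  by rewrite sym_gen_even; apply: mp_homogX.
by rewrite sym_gen_odd; apply: mp_homogC; apply: gr_gen_homog.
Qed.

Lemma mp_homog_image (B : 'M[L]_(p + q)) j :
  smx_even B -> mp_homog (sparity j) (sym_image B j).
Proof.
move=> hB; rewrite /sym_image; elim/big_rec: _ => [|i s _ hs].
  exact: mp_homog0.
apply: mp_homogD => //; have := mp_homogM (mp_homog_gen (i := i)) (mp_homog_embed (hB i j)).
by rewrite addbA addbb.
Qed.

Lemma sym_deg_image (B : 'M[L]_(p + q)) j : sym_deg 1 (sym_image B j).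
Proof.
rewrite /sym_image; elim/big_rec: _ => [|i s _ hs]; first exact: sym_deg0.
apply: sym_degD => //; rewrite -[1%N]addn0.
by apply: sym_degM; [apply: sym_deg_gen|apply: sym_deg_embed].
Qed.

Definition sym_act (B : 'M[L]_(p + q)) (b : I) : T :=
  (\prod_(a < q | a \in (val b).2) sym_image B (rshift p a)) *
  (\prod_(mu < p) sym_image B (lshift q mu) ^+ (bmnm (val b).1 mu)).

Lemma sym_deg_act B b : sym_deg r (sym_act B b).
Proof.
have -> : r = (\sum_(a < q | a \in (val b).2) 1 + \sum_(mu < p) bmnm (val b).1 mu * 1)%N.
  rewrite sum1_card; under eq_bigr do rewrite muln1.
  by rewrite -mdegE addnC (eqP (valP b)).
apply: sym_degM; apply: sym_deg_prod => i _; first exact: sym_deg_image.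
by apply: sym_degX; apply: sym_deg_image.
Qed.

Lemma sym_act_morph (f : {rmorphism T -> T}) (B C : 'M[L]_(p + q)) b :
  (forall j, f (sym_image B j) = sym_image C j) -> f (sym_act B b) = sym_act C b.
Proof.
move=> fB; rewrite rmorphM !rmorph_prod; congr (_ * _); apply: eq_bigr => i _.
  exact: fB.
by rewrite rmorphXn; congr (_ ^+ _); apply: fB.
Qed.

Lemma sym_embedM (c d : L) : sym_embed p q (c * d) = sym_embed p q c * sym_embed p q d.
Proof. by rewrite /sym_embed !rmorphM. Qed.

Lemma sym_image_mulmx (f : {rmorphism T -> T}) (B C : 'M[L]_(p + q)) :
  (forall i, f (sym_gen K N i) = sym_image B i) ->
  (forall c, f (sym_embed p q c) = sym_embed p q c) ->
  forall j, f (sym_image C j) = sym_image (B *m C) j.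
Proof.
move=> f_gen f_emb j; rewrite /sym_image rmorph_sum.
under eq_bigr do rewrite rmorphM [X in X * _]f_gen [X in _ * X]f_emb mulr_suml.
rewrite exchange_big; apply: eq_bigr => i _.
under eq_bigr do rewrite -mulrA -sym_embedM.
by rewrite -mulr_sumr mxE /sym_embed !rmorph_sum.
Qed.

(** The operator induced by B extends to an endomorphism f of the algebra S(W)
    that fixes the scalars, and f maps the image of a generator under C to its
    image under B C. It remains to apply f to the expansion of the image of b'
    under C in the basis of S^r. *)
Lemma sym_power_mulmx (B C : 'M[L]_(p + q)) (b b' : I) : smx_even B ->
  sym_power (B *m C) b b' = \sum_b'' sym_power B b b'' * sym_power C b'' b'.
Proof.
move=> hB.
have w_even mu : mp_homog false (sym_image B (lshift q mu)).
  by rewrite -(sparity_lshift q mu); apply: mp_homog_image.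
have w_odd a : mp_homog true (sym_image B (rshift p a)).
  by rewrite -(sparity_rshift p a); apply: mp_homog_image.
have [f [f_gen f_emb]] := sym_alg_universal w_even w_odd.
have powerE (D : 'M[L]_(p + q)) b1 b2 : sym_power D b1 b2 = sym_coef b1 (sym_act D b2).
  by [].
rewrite powerE.
have fC := @sym_image_mulmx f B C f_gen f_emb.
rewrite -(sym_act_morph b' fC).
rewrite [sym_act C b']sym_expand; last exact: sym_deg_act.
rewrite rmorph_sum sym_coef_sum; apply: eq_bigr => b'' _.
rewrite rmorphM [X in _ * X]f_emb sym_coefM powerE; congr (sym_coef _ _ * _).
rewrite -sym_mon_prod rmorphM !rmorph_prod; congr (_ * _); apply: eq_bigr => i _.
  exact: f_gen.
by rewrite rmorphXn; congr (_ ^+ _); apply: f_gen.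
Qed.

End SymmetricFunctor.

(** * Supertraces of symmetric powers *)

Section SuperTrace.
Variables (K : numFieldType) (N : nat).
Notation L := (grassmann K N).

Lemma eq_Str (I : finType) (par : I -> bool) (X Y : I -> I -> L) :
  (forall i, X i i = Y i i) -> Str par X = Str par Y.
Proof. by move=> eqXY; rewrite /Str; under eq_bigr do rewrite eqXY. Qed.

(** The homogeneous elements X i k and Y k i commute up to the sign
    (-1)^(par i + par k), which is the quotient of the signs of the two
    supertraces. *)
Lemma Str_mulC (I : finType) (par : I -> bool) (X Y : I -> I -> L) :
  (forall i j, gr_homog (par i (+) par j) (X i j)) ->
  (forall i j, gr_homog (par i (+) par j) (Y i j)) ->
  Str par (fun i j => \sum_k X i k * Y k j) =
  Str par (fun i j => \sum_k Y i k * X k j).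
Proof.
move=> hX hY; rewrite /Str; under eq_bigr do rewrite mulr_sumr.
rewrite exchange_big; apply: eq_bigr => k _; rewrite mulr_sumr.
apply: eq_bigr => i _; rewrite (gr_supercomm (hX i k) (hY k i)) mulrA -signr_addb.
by congr (_ ^+ nat_of_bool _ * _); case: (par i); case: (par k).
Qed.

Lemma parity_reversed_mulmx n m (A B : 'M[L]_(n + m)) :
  parity_reversed (A *m B) = parity_reversed A *m parity_reversed B.
Proof.
have E := mulmx_block (ulsubmx A) (ursubmx A) (dlsubmx A) (drsubmx A)
  (ulsubmx B) (ursubmx B) (dlsubmx B) (drsubmx B).
rewrite !submxK in E.
rewrite /parity_reversed mulmx_block {1 2 3 4}E.
rewrite block_mxKul block_mxKur block_mxKdl block_mxKdr.
by congr block_mx; rewrite addrC.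
Qed.

Lemma parity_reversed_even n m (A : 'M[L]_(n + m)) :
  smx_even A -> smx_even (parity_reversed A).
Proof.
case/smx_even_block=> ha hb hc hd i j.
have sE := (sparity_lshift, sparity_rshift).
case: (split_ordP i) => i' ->; case: (split_ordP j) => j' ->; rewrite !sE /parity_reversed.
- by rewrite block_mxEul; apply: hd.
- by rewrite block_mxEur; apply: hc.
- by rewrite block_mxEdl; apply: hb.
- by rewrite block_mxEdr; apply: ha.
Qed.

Lemma smx_evenM n m (A B : 'M[L]_(n + m)) :
  smx_even A -> smx_even B -> smx_even (A *m B).
Proof.
move=> hA hB i j; rewrite mxE; apply: gr_homog_sum => k _.
have := gr_homogM (hA i k) (hB k j).
by case: (sparity i); case: (sparity j); case: (sparity k).
Qed.

(** The component of the right parity in Q is itself a right inverse of P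
    (gr_partM), hence equal to Q. *)
Lemma smx_even_inv n m (P Q : 'M[L]_(n + m)) :
  smx_even P -> P *m Q = 1%:M -> Q *m P = 1%:M -> smx_even Q.
Proof.
move=> hP PQ QP.
(* Entry by entry, the component of Q that an even matrix has there. *)
pose Q' : 'M[L]_(n + m) := \matrix_(i, j) gr_part (sparity i (+) sparity j) (Q i j).
suff -> : Q = Q' by move=> i j; rewrite mxE; apply: gr_part_homog.
have PQ' : P *m Q' = 1%:M.
  apply/matrixP=> i j; rewrite -[in RHS](gr_part_id (p := sparity i (+) sparity j)
    (x := (1%:M : 'M[L]_(n + m)) i j)).
    rewrite -PQ !mxE gr_part_sum; apply: eq_bigr => k _; rewrite mxE.
    rewrite -(gr_partM _ _ (hP i k)); congr (gr_part _ _).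
    by case: (sparity i); case: (sparity j); case: (sparity k).
  rewrite mxE; have [->|_] := eqVneq i j; last exact: gr_homog0.
  by rewrite addbb; apply: gr_homog1.
by rewrite -[LHS]mulmx1 -PQ' mulmxA QP mul1mx.
Qed.

Section SymmetricPowerTrace.
Variables p q r : nat.
Notation T := (mpoly p (grassmann K (q + N))).
Notation I := (sym_basis p q r).

Lemma mp_homog_prod (J : Type) (e : seq J) (P : pred J) (F : J -> T) b :
  (forall i, P i -> mp_homog b (F i)) ->
  mp_homog (b && odd (count P e)) (\prod_(i <- e | P i) F i).
Proof.
move=> hF; elim: e => [|i e IH].
  by rewrite big_nil andbF; apply: mp_homog1.
rewrite big_cons /=; case: ifP => Pi; last by rewrite add0n.
have := mp_homogM (hF i Pi) IH.
by rewrite oddD /=; case: (b).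
Qed.

Lemma mp_homogXn (s : T) n : mp_homog false s -> mp_homog false (s ^+ n).
Proof.
move=> hs; elim: n => [|n IH]; first by rewrite expr0; apply: mp_homog1.
by rewrite exprS; apply: (mp_homogM hs IH).
Qed.

Lemma sym_power_parity (B : 'M[L]_(p + q)) (b b' : I) : smx_even B ->
  gr_homog (sym_parity b (+) sym_parity b') (sym_power B b b').
Proof.
move=> hB; apply: gr_coef_homog; set s := (X in mcoeff _ X).
suff : mp_homog (sym_parity b') s by apply.
rewrite -[sym_parity b']addbF; apply: mp_homogM; last first.
  have := @mp_homog_prod _ (index_enum 'I_p) xpredT
    (fun mu => sym_image B (lshift q mu) ^+ bmnm (val b').1 mu) false.
  apply=> mu _; apply: mp_homogXn.
  by rewrite -(sparity_lshift q mu); apply: mp_homog_image.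
have := @mp_homog_prod _ (index_enum 'I_q) [in (val b').2]
    (fun a => sym_image B (rshift p a)) true.
rewrite -sum1_count sum1_card; apply=> a _.
by rewrite -(sparity_rshift p a); apply: mp_homog_image.
Qed.

(** By functoriality S^r(P B Q) = S^r(P) S^r(B Q), and the supertrace of the
    product in the other order is that of S^r(B Q P) = S^r(B). *)
Lemma Str_sym_power_conj (B P Q : 'M[L]_(p + q)) :
  smx_even B -> smx_even P -> smx_even Q -> Q *m P = 1%:M ->
  Str (@sym_parity p q r) (sym_power (P *m (B *m Q))) =
  Str (@sym_parity p q r) (sym_power B).
Proof.
move=> hB hP hQ QP; have hBQ := smx_evenM hB hQ.
rewrite -[in RHS](mulmx1 B) -QP [in RHS]mulmxA.
transitivity (Str (@sym_parity p q r)
    (fun b b' => \sum_k sym_power P b k * sym_power (B *m Q) k b')).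
  by apply: eq_Str => b; rewrite sym_power_mulmx.
rewrite Str_mulC => [||b b']; first last.
- exact: sym_power_parity.
- by move=> b b'; apply: sym_power_parity.
by apply: eq_Str => b; rewrite sym_power_mulmx.
Qed.

(** The even scalars d i are central, and can be collected to the right of the
    generators. *)
Lemma sym_power_diag (d : 'I_(p + q) -> L) (b : I) :
  (forall i, gr_homog false (d i)) ->
  sym_power (\matrix_(i, j) (d i *+ (i == j))) b b =
  \prod_(a in (val b).2) d (rshift p a) * \prod_mu d (lshift q mu) ^+ bmnm (val b).1 mu.
Proof.
move=> hd; set D := \matrix_(i, j) _.
have imgE j : sym_image D j = sym_gen K N j * sym_embed p q (d j).
  rewrite /sym_image (bigD1 j) //= mxE eqxx big1 ?addr0 // => i /negPf ni.
  by rewrite mxE ni mulr0n /sym_embed !rmorph0 mulr0.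
have dX n j : gr_homog false (d j ^+ n).
  elim: n => [|n IH]; first by rewrite expr0; apply: gr_homog1.
  by rewrite exprS; apply: (gr_homogM (hd j) IH).
have embC c s : gr_homog false c -> sym_embed p q c * s = s * sym_embed p q c :> T.
  by move=> hc; apply: mp_even_comm; apply: mp_homog_embed.
have prodE (J : finType) (P : pred J) (g : J -> T) (c : J -> L) :
    (forall i, gr_homog false (c i)) ->
    \prod_(i | P i) (g i * sym_embed p q (c i))
    = \prod_(i | P i) g i * sym_embed p q (\prod_(i | P i) c i).
  move=> hc; have -> : sym_embed p q (\prod_(i | P i) c i)
      = \prod_(i | P i) sym_embed p q (c i).
    by rewrite /sym_embed !rmorph_prod.
  elim/big_rec3: _ => [|i x y z _ ->]; first by rewrite mulr1.
  by rewrite -!mulrA; congr (_ * _); rewrite mulrA embC // -!mulrA.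
have embX n j : sym_embed p q (d j) ^+ n = sym_embed p q (d j ^+ n) :> T.
  by rewrite /sym_embed !rmorphXn.
have -> : sym_power D b b = sym_coef b (sym_mon K N (val b).1 (val b).2 *
    sym_embed p q (\prod_(a in (val b).2) d (rshift p a)
                   * \prod_mu d (lshift q mu) ^+ bmnm (val b).1 mu)).
  rewrite /sym_power; congr sym_coef.
  have -> : \prod_(a in (val b).2) sym_image D (rshift p a)
      = \prod_(a in (val b).2) sym_gen K N (rshift p a)
        * sym_embed p q (\prod_(a in (val b).2) d (rshift p a)).
    by rewrite -prodE //; apply: eq_bigr => a _; apply: imgE.
  have -> : \prod_mu sym_image D (lshift q mu) ^+ bmnm (val b).1 mu
      = \prod_mu sym_gen K N (lshift q mu) ^+ bmnm (val b).1 mu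
        * sym_embed p q (\prod_mu d (lshift q mu) ^+ bmnm (val b).1 mu).
    rewrite -prodE //; apply: eq_bigr => mu _.
    by rewrite imgE exprMn_comm ?embX // /GRing.comm embC.
  rewrite -sym_mon_prod sym_embedM mulrA -[X in X * _ = _]mulrA embC.
    by rewrite !mulrA.
  by elim/big_ind: _ => [|x y|i _]; [apply: gr_homog1|apply: gr_homogM|].
by rewrite sym_coef_mon eqxx.
Qed.

End SymmetricPowerTrace.
End SuperTrace.

From mathcomp Require Import boolp topology normedtype sequences ring.

Import Order.TTheory numFieldNormedType.Exports.

(** * Convergence *)

Section GeometricConvergence.
Variable R : realType.
Local Open Scope classical_set_scope.
Local Open Scope complex_scope.

(** If a is smaller than (e / 2) (1 - rho) from M on, then
    s (M + j) <= rho^j s M + e / 2 for all j. *)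
Lemma real_contraction (rho : R) (s a : nat -> R) : 0 <= rho -> rho < 1 ->
  (forall k, 0 <= s k) -> (forall k, s k.+1 <= rho * s k + a k) ->
  (forall e, 0 < e -> exists M, forall k, (M <= k)%N -> a k < e) ->
  forall e, 0 < e -> exists M, forall k, (M <= k)%N -> s k < e.
Proof.
move=> rho0 rho1 s0 sS a0 e e0.
have d0 : 0 < e / 2 * (1 - rho) by rewrite mulr_gt0 ?divr_gt0 // subr_gt0.
have [M aM] := a0 _ d0.
have bound j : s (M + j)%N <= rho ^+ j * s M + e / 2.
  elim: j => [|j IH]; first by rewrite addn0 expr0 mul1r lerDl divr_ge0 // ltW.
  rewrite addnS; apply: le_trans (sS _) _.
  have := ltW (aM _ (leq_addr j M)); move: (ler_wpM2l rho0 IH).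
  rewrite mulrDr mulrA -exprS => h1 h2.
  apply: le_trans (lerD h1 h2) _.
  by rewrite -addrA lerD2l mulrBr mulr1 mulrC addrC subrK.
have e20 : 0 < e / 2 by rewrite divr_gt0.
have : geometric (s M) rho @ \oo --> 0 by apply: cvg_geometric; rewrite ger0_norm.
move=> /cvgr0Pnorm_lt /(_ _ e20) [J _ hJ].
exists (M + J)%N => k MJk.
have Mk : (M <= k)%N by apply: leq_trans MJk; apply: leq_addr.
rewrite -(subnKC Mk); apply: le_lt_trans (bound _) _.
rewrite [ltRHS]splitr ltrD2r; apply: le_lt_trans (hJ (k - M)%N _); last first.
  by rewrite /= leq_subRL.
by rewrite /= mulrC ler_norm.
Qed.

Lemma complex_contraction (rho : R[i]) (s a : nat -> R[i]^o) : `|rho| < 1 ->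
  (forall k, s k.+1 = rho * s k + a k) -> a @ \oo --> (0 : R[i]^o) ->
  s @ \oo --> (0 : R[i]^o).
Proof.
move=> rho1 sS /cvgr0Pnorm_lt a0; apply/cvgr0Pnorm_lt => e e0.
have nE (x : R[i]) : `|x| = (complex.Re `|x|)%:C by case: x.
have ltE (x : R[i]) (d : R[i]) : 0 < d -> (`|x| < d) = (complex.Re `|x| < complex.Re d).
  move=> d0; have dE : d = (complex.Re d)%:C.
    by move: d0; case: d => d1 d2; rewrite ltcE /= => /andP[/eqP -> _].
  by rewrite nE dE ltcR.
have Re_gt0 (d : R[i]) : 0 < d -> 0 < complex.Re d.
  by case: d => d1 d2; rewrite ltcE /= => /andP[_].
have real_a d : 0 < d -> exists M, forall k, (M <= k)%N -> complex.Re `|a k| < d.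
  move=> d0; have d0' : 0 < d%:C :> R[i] by rewrite ltcR.
  by have [M _ hM] := a0 _ d0'; exists M => k Mk; have := hM k Mk; rewrite /= ltE.
have Re_ge0 (x : R[i]) : 0 <= complex.Re `|x|.
  by have := normr_ge0 x; rewrite nE lecR.
have ReD (x y : R[i]) : complex.Re `|x + y| <= complex.Re `|x| + complex.Re `|y|.
  by have := ler_normD x y; rewrite [`|x + y|]nE [`|x|]nE [`|y|]nE -rmorphD lecR.
have ReM (x y : R[i]) : complex.Re `|x * y| = complex.Re `|x| * complex.Re `|y|.
  by rewrite normrM [`|x|]nE [`|y|]nE -rmorphM.
have [||M hM] := @real_contraction (complex.Re `|rho|) (fun k => complex.Re `|s k|)
    (fun k => complex.Re `|a k|) (Re_ge0 _) _ (fun k => Re_ge0 _) _ real_a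
    (complex.Re e) (Re_gt0 _ e0).
- by rewrite -(ltE _ 1).
- by move=> k; rewrite sS -ReM.
by exists M => // k Mk; rewrite /= ltE //; apply: hM.
Qed.

Lemma cvg0D (f g : nat -> R[i]^o) : f @ \oo --> (0 : R[i]^o) ->
  g @ \oo --> (0 : R[i]^o) -> (fun j => f j + g j : R[i]^o) @ \oo --> (0 : R[i]^o).
Proof. by move=> f0 g0; rewrite -[0 : R[i]^o]addr0; apply: cvgD. Qed.

Lemma cvg0_sum (I : Type) (r : seq I) (P : pred I) (F : I -> nat -> R[i]^o) :
  (forall i, P i -> F i @ \oo --> (0 : R[i]^o)) ->
  (fun j => \sum_(i <- r | P i) F i j : R[i]^o) @ \oo --> (0 : R[i]^o).
Proof.
move=> F0; elim: r => [|i r IH].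
  under eq_fun do rewrite big_nil.
  exact: cvg_cst.
have [Pi|/negPf nPi] := boolP (P i); last by under eq_fun do rewrite big_cons nPi.
under eq_fun do rewrite big_cons Pi.
exact: (cvg0D (F0 i Pi) IH).
Qed.

Variable N : nat.
Notation L := (grassmann R[i] N).

Definition gr_cvg (s : nat -> L) (l : L) : Prop :=
  forall S : {set 'I_N}, (fun k => s k S : R[i]^o) @ \oo --> (l S : R[i]^o).

(** Induction on |S|. In the coefficient of theta_S in u s, the body of u
    multiplies the coefficient of theta_S in s, which gives a contraction, and all
    other terms involve coefficients of s on smaller sets, which tend to zero. *)
Lemma gr_contraction (u : L) (s a : nat -> L) : `|body u| < 1 ->
  (forall k, s k.+1 = u * s k + a k) -> gr_cvg a 0 -> gr_cvg s 0.
Proof.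
move=> u1 sS a0 S; rewrite gr0.
have [k] := ubnP #|S|; elim: k S => // k IH S; rewrite ltnS => Sk.
pose b j : R[i]^o := \sum_(T : {set 'I_N} | (T \subset S) && (T != set0))
  ((-1) ^+ inversions T (S :\: T) * (u T * s j (S :\: T))) + a j S.
apply: (@complex_contraction (body u) _ b) => // [j|].
  rewrite sS grD grM (bigD1 set0) ?sub0set //= setD0 inversions0l mul1r.
  by rewrite -addrA.
have {}a0 := a0 S; rewrite gr0 in a0.
apply: cvg0D => //.
apply: cvg0_sum => T /andP[sTS T0].
have ltT : (#|S :\: T| < k)%N.
  apply: leq_trans Sk; rewrite -(cardsID T S) (setIidPr sTS) -{1}[#|S :\: T|]add0n.
  by rewrite ltn_add2r card_gt0.
have := IH _ ltT => h.
under eq_fun do rewrite mulrA.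
by rewrite -[0 : R[i]^o](mulr0 ((-1) ^+ inversions T (S :\: T) * u T)); apply: cvgMl_tmp.
Qed.

Lemma gr_cvgD s t l k : gr_cvg s l -> gr_cvg t k -> gr_cvg (fun i => s i + t i) (l + k).
Proof.
move=> hs ht S; rewrite grD; under eq_fun do rewrite grD.
exact: (cvgD (hs S) (ht S)).
Qed.

Lemma gr_cvg_cst l : gr_cvg (fun=> l) l.
Proof. by move=> S; apply: cvg_cst. Qed.

Lemma gr_cvg_shift s l : gr_cvg (fun k => s k.+1) l <-> gr_cvg s l.
Proof.
have e S := cvg_shiftS (fun k => s k S : R[i]^o) (nbhs (l S : R[i]^o)).
by split=> h S; have := h S; rewrite -e.
Qed.

(** The limit v is the fixed point v = u v + l, and s - v satisfies the
    recursion of gr_contraction. *)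
Lemma gr_cvg_geometric (u : L) (s t : nat -> L) (l : L) : `|body u| < 1 ->
  (forall k, s k.+1 = u * s k + t k.+1) -> gr_cvg t l -> gr_cvg s ((1 - u)^-1 * l).
Proof.
move=> u1 sS tl; have unit1u : 1 - u \is a GRing.unit.
  rewrite gr_unit_body rmorphB rmorph1 subr_eq0; apply: contraTneq u1 => <-.
  by rewrite normr1 ltxx.
pose v := (1 - u)^-1 * l; have vE : u * v + l = v.
  have -> : u * v = v - (1 - u) * v by rewrite mulrBl mul1r opprB addrC subrK.
  by rewrite /v [(1 - u) * _]mulrA divrr // mul1r subrK.
have : gr_cvg (fun k => s k - v) 0.
  apply: (@gr_contraction u _ (fun k => t k.+1 - l) u1) => [k|].
    by rewrite sS mulrBr -{1}vE opprD addrACA.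
  rewrite -(subrr l); apply: (@gr_cvgD (fun k => t k.+1) (fun=> - l)).
    exact/gr_cvg_shift.
  exact: gr_cvg_cst.
move/gr_cvgD/(_ (@gr_cvg_cst v)); rewrite add0r.
move=> h S; have := h S.
by under eq_fun do rewrite subrK.
Qed.

End GeometricConvergence.

(** * Generating functions *)

Section GeneratingFunction.
Variable C : comNzRingType.

(** The coefficients of E(X) / prod_u (1 - u X), for a power series E. *)
Fixpoint geom_coef (E : nat -> C) (us : seq C) : nat -> C :=
  if us is u :: us' then
    fun r => \sum_(k < r.+1) u ^+ k * geom_coef E us' (r - k)%N
  else E.

Lemma geom_coefS E u us r :
  geom_coef E (u :: us) r.+1 = u * geom_coef E (u :: us) r + geom_coef E us r.+1.
Proof.
rewrite /= big_ord_recl expr0 mul1r subn0 addrC mulr_sumr; congr (_ + _).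
by apply: eq_bigr => k _; rewrite exprS mulrA.
Qed.

(** The sum over r <= M of geom_coefS, in the form required by
    gr_cvg_geometric. *)
Lemma geom_coef_sumS E u us M :
  \sum_(r < M.+1) geom_coef E (u :: us) r =
  u * (\sum_(r < M) geom_coef E (u :: us) r) + \sum_(r < M.+1) geom_coef E us r.
Proof.
rewrite big_ord_recl [in RHS]big_ord_recl.
have -> : geom_coef E (u :: us) 0%N = geom_coef E us 0%N.
  by rewrite /= big_ord1 expr0 mul1r.
rewrite addrCA.
congr (_ + _); rewrite mulr_sumr -big_split; apply: eq_bigr => r _.
exact: geom_coefS.
Qed.

(** Up to degree M the geometric series can be truncated to polynomials. *)
Lemma geom_coefE (P : {poly C}) us M r : (r <= M)%N ->
  (P * \prod_(u <- us) \poly_(k < M.+1) u ^+ k)`_r = geom_coef (fun k => P`_k) us r.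
Proof.
elim: us r => [|u us IH] r rM; first by rewrite big_nil mulr1.
rewrite big_cons mulrCA mulrC coefMr /=; apply: eq_bigr => k _.
have kr : (k <= r)%N by rewrite -ltnS.
rewrite IH ?(leq_trans (leq_subr _ _)) // coef_poly ltnS (leq_trans kr rM) mulrC.
by [].
Qed.

Lemma prod_1DX n (c : 'I_n -> C) :
  \prod_a (1 + c a *: 'X) = \sum_(Q : {set 'I_n}) (\prod_(a in Q) c a) *: 'X^#|Q|.
Proof.
rewrite (eq_bigr (fun a => c a *: 'X + 1)); last by move=> a _; rewrite addrC.
rewrite bigA_distr; apply: eq_bigr => Q _.
rewrite -big_mkcond /= (eq_bigr (fun a => (c a)%:P * 'X)); last first.
  by move=> a _; rewrite mul_polyC.
by rewrite big_split /= prodr_const -rmorph_prod mul_polyC.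
Qed.

Lemma prod_geom m r (u : 'I_m -> C) :
  \prod_mu \poly_(k < r) u mu ^+ k =
  \sum_(f : {ffun 'I_m -> 'I_r}) (\prod_mu u mu ^+ f mu) *: 'X^(\sum_mu f mu).
Proof.
under eq_bigr do rewrite poly_def.
rewrite bigA_distr_bigA; apply: eq_bigr => f _.
under eq_bigr do rewrite -mul_polyC.
by rewrite big_split /= -rmorph_prod mul_polyC -expr_sum.
Qed.

(** Each choice of a term in every factor of the product, of total degree r, is
    a basis vector of S^r: the set Q of the factors 1 + c a X in which c a X is
    chosen, and the exponents of X in the other factors. *)
Lemma sym_basis_sum m n r (c : 'I_n -> C) (u : 'I_m -> C) :
  \sum_(b : sym_basis m n r)
     \prod_(a in (val b).2) c a * \prod_mu u mu ^+ bmnm (val b).1 mu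
  = (\prod_a (1 + c a *: 'X) * \prod_mu \poly_(k < r.+1) u mu ^+ k)`_r.
Proof.
rewrite prod_1DX prod_geom big_distrlr pair_big /= coef_sum.
pose cond (w : {set 'I_n} * {ffun 'I_m -> 'I_r.+1}) :=
  (\sum_mu w.2 mu + #|w.1| == r)%N.
transitivity (\sum_(w | cond w) \prod_(a in w.1) c a * \prod_mu u mu ^+ w.2 mu); last first.
  rewrite big_mkcond; apply: eq_bigr => -[Q f] _.
  rewrite -scalerAl -scalerAr scalerA -exprD coefZ coefXn /cond /= eq_sym addnC.
  by case: eqP => _; rewrite ?mulr1 ?mulr0.
pose h (b : sym_basis m n r) : {set 'I_n} * {ffun 'I_m -> 'I_r.+1} :=
  ((val b).2, [ffun mu => inord (bmnm (val b).1 mu)]).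
(* A partial inverse of h: its domain may be inhabited when sym_basis is not. *)
pose h' (w : {set 'I_n} * {ffun 'I_m -> 'I_r.+1}) : option (sym_basis m n r) :=
  obind (fun k => insub (k, w.1)) (insub (Multinom [tuple (w.2 mu : nat) | mu < m])).
have hE b mu : (h b).2 mu = bmnm (val b).1 mu :> nat.
  rewrite ffunE inordK // ltnS; apply: leq_trans (bmdeg (val b).1 : (_ <= r)%N).
  by rewrite mdegE (bigD1 mu) //= leq_addr.
rewrite (reindex_omap h h') => [|[Q f] cw].
  apply: esym; apply: eq_big => [b|b _].
    apply/andP; split.
      rewrite /cond; under eq_bigr do rewrite hE.
      by rewrite -mdegE; apply: (valP b).
    rewrite /h' (_ : Multinom _ = bmnm (val b).1).
      by rewrite valK /= -surjective_pairing valK.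
    by apply/mnmP=> mu; rewrite mnmE hE.
  by congr (_ * _); apply: eq_bigr => mu _; rewrite hE.
set k := Multinom [tuple (f mu : nat) | mu < m].
have kE mu : k mu = f mu by rewrite mnmE.
have degk : mdeg k = (\sum_mu f mu)%N by rewrite mdegE; apply: eq_bigr => mu _; rewrite kE.
have ltk : (mdeg k < r.+1)%N.
  by rewrite ltnS degk; apply: leq_trans (leq_addr #|Q| _) _; rewrite (eqP cw).
rewrite /h' /= insubT /= insubT /=; first by rewrite degk.
move=> Pb; congr Some; congr (_, _); apply/ffunP => mu; apply: val_inj.
by rewrite /= ffunE inordK kE.
Qed.

End GeneratingFunction.

Section Sum.
Variables (R : realType) (N : nat).
Notation L := (grassmann R[i] N).
Notation Ev := (even_gr R[i] N).

Lemma gr_cvg_geom_coef (P : {poly Ev}) (us : seq Ev) :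
  (forall u, u \in us -> `|body (val u)| < 1) ->
  gr_cvg (fun M => val (\sum_(r < M) geom_coef (fun k => P`_k) us r))
    (val (P.[1] * (\prod_(u <- us) (1 - u)^-1))).
Proof.
elim: us => [|u us IH] us1.
  rewrite big_nil mulr1.
  move=> S; apply: cvg_near_cst; exists (size P) => // M /= sP.
  suff -> : \sum_(r < M) P`_r = P.[1] by [].
  rewrite horner_coef -(big_mkord xpredT (fun k => P`_k)).
  rewrite (big_cat_nat (leq0n _) sP) //= big_mkord.
  rewrite [X in _ + X]big1_seq ?addr0; last first.
    by move=> k; rewrite mem_index_iota => /andP[_ /andP[sk _]]; rewrite nth_default.
  by apply: eq_bigr => k _; rewrite expr1n mulr1.
have u1 : `|body (val u)| < 1 by apply: us1; rewrite mem_head.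
have unit1u : 1 - u \is a GRing.unit.
  apply: even_gr_unit; rewrite gr_unit_body !rmorphB !rmorph1 /= subr_eq0.
  apply: contraTneq u1 => <-.
  by rewrite normr1 ltxx.
rewrite big_cons mulrCA rmorphM (rmorphV _ unit1u) rmorphB rmorph1.
apply: (gr_cvg_geometric u1 (t := fun M => val (\sum_(r < M) geom_coef (fun k => P`_k) us r))).
  by move=> M; rewrite geom_coef_sumS rmorphD rmorphM.
by apply: IH => v vus; apply: us1; rewrite inE vus orbT.
Qed.
End Sum.

(** * Diagonal operators *)

Section Diagonalization.
Variables (K : numFieldType) (N n m : nat).
Notation L := (grassmann K N).
Variables (e : 'I_n -> 'cV[L]_(n + m)) (eh : 'I_m -> 'cV[L]_(n + m)).

Definition basis_mx : 'M[L]_(n + m) :=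
  row_mx (\matrix_(i, a) e a i 0) (\matrix_(i, mu) eh mu i 0).

Lemma basis_mx_mul (c : 'cV[L]_(n + m)) : basis_mx *m c =
  \sum_(a < n) e a *m (c (lshift m a) 0)%:M + \sum_(mu < m) eh mu *m (c (rshift n mu) 0)%:M.
Proof.
apply/matrixP=> i j; rewrite ord1 !mxE !summxE big_split_ord /=.
by congr (_ + _); apply: eq_bigr => k _; rewrite ?row_mxEl ?row_mxEr !mxE big_ord1 !mxE mulr1n.
Qed.

Hypothesis e_basis : homogeneous_basis e eh.

Lemma basis_mx_even : smx_even basis_mx.
Proof.
case: e_basis => he heh _ i j; case: (split_ordP j) => k ->.
  by rewrite sparity_lshift /basis_mx row_mxEl mxE; apply: he.
by rewrite sparity_rshift /basis_mx row_mxEr mxE; apply: heh.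
Qed.

(** Existence of coordinates gives a right inverse; their uniqueness shows
    that it is a left inverse. *)
Lemma basis_mx_inv : exists Q, basis_mx *m Q = 1%:M /\ Q *m basis_mx = 1%:M.
Proof.
case: e_basis => _ _ spanning.
have inj (c c' : 'cV[L]_(n + m)) : basis_mx *m c = basis_mx *m c' -> c = c'.
  have [c0 [_ c0u]] := spanning (basis_mx *m c).
  move=> ecc'; rewrite -(c0u c); last by rewrite -basis_mx_mul.
  by apply: c0u; rewrite ecc' basis_mx_mul.
have Qcol j : exists c : 'cV[L]_(n + m), basis_mx *m c = col j 1%:M.
  by have [c [ec _]] := spanning (col j 1%:M); exists c; rewrite basis_mx_mul -ec.
have [q qP] := choice Qcol.
have colM (A B : 'M[L]_(n + m)) j : col j (A *m B) = A *m col j B.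
  by rewrite !colE mulmxA.
pose Q : 'M[L]_(n + m) := \matrix_(i, j) q j i 0.
have colQ j : col j Q = q j by apply/matrixP=> i k; rewrite !mxE ord1.
have PQ : basis_mx *m Q = 1%:M.
  apply/matrixP=> i j; have /matrixP/(_ i 0) := qP j.
  by rewrite -colQ -colM !mxE.
exists Q; split=> //; apply/matrixP=> i j.
suff /matrixP/(_ i 0) : col j (Q *m basis_mx) = col j 1%:M by rewrite !mxE.
by apply: inj; rewrite -!colM mulmxA PQ mul1mx mulmx1.
Qed.

Lemma basis_mx_eigen (B : 'M[L]_(n + m)) (x : 'I_n -> L) (y : 'I_m -> L) :
  (forall a, B *m e a = e a *m (x a)%:M) ->
  (forall mu, B *m eh mu = eh mu *m (y mu)%:M) ->
  B *m basis_mx = basis_mx *m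
    block_mx (diag_mx (\row_a x a)) 0 0 (diag_mx (\row_mu y mu)).
Proof.
move=> Be Beh; rewrite /basis_mx mul_mx_row mul_row_block !mulmx0 addr0 add0r.
congr row_mx; apply/matrixP=> i j.
  have /matrixP/(_ i 0) := Be j; rewrite !mxE big_ord1 !mxE mulr1n => Bej.
  rewrite [RHS](bigD1 j) //= [X in _ = _ + X]big1 ?addr0; last first.
    by move=> k /negPf nk; rewrite !mxE nk mulr0n mulr0.
  by rewrite !mxE eqxx mulr1n -Bej; apply: eq_bigr => k _; rewrite !mxE.
have /matrixP/(_ i 0) := Beh j; rewrite !mxE big_ord1 !mxE mulr1n => Bej.
rewrite [RHS](bigD1 j) //= [X in _ = _ + X]big1 ?addr0; last first.
  by move=> k /negPf nk; rewrite !mxE nk mulr0n mulr0.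
by rewrite !mxE eqxx mulr1n -Bej; apply: eq_bigr => k _; rewrite !mxE.
Qed.

End Diagonalization.

Lemma regroup_signs (C : comPzRingType) (z s t X Y : C) (d q : nat) : s ^+ 2 = 1 ->
  z ^+ d * z ^+ q * (t * s) * (s * (X * Y)) = z ^+ q * X * (z ^+ d * t * Y).
Proof. by move=> s2; rewrite -[RHS]mul1r -s2; ring. Qed.

Lemma val_sum (K : comNzRingType) N (I : Type) (r : seq I) (P : pred I)
    (F : I -> even_gr K N) :
  val (\sum_(i <- r | P i) F i) = \sum_(i <- r | P i) val (F i).
Proof. exact: rmorph_sum. Qed.

Section SupertraceOfPower.
Variables (K : numFieldType) (N n m : nat).
Notation L := (grassmann K N).
Notation Ev := (even_gr K N).

Lemma even_lift (I : Type) (f : I -> L) : (forall i, gr_homog false (f i)) ->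
  exists g : I -> Ev, forall i, f i = val (g i).
Proof. by move=> hf; exists (fun i => EvenGr (introT (gr_evenP _) (hf i))). Qed.

Definition split_fun (T : Type) p q (f : 'I_p -> T) (g : 'I_q -> T) (i : 'I_(p + q)) : T :=
  match split i with inl j => f j | inr k => g k end.

Lemma split_fun_lshift (T : Type) p q (f : 'I_p -> T) (g : 'I_q -> T) i :
  split_fun f g (lshift q i) = f i.
Proof. by rewrite /split_fun -[lshift q i]/(unsplit (inl i)) unsplitK. Qed.

Lemma split_fun_rshift (T : Type) p q (f : 'I_p -> T) (g : 'I_q -> T) i :
  split_fun f g (rshift p i) = g i.
Proof. by rewrite /split_fun -[rshift p i]/(unsplit (inr i)) unsplitK. Qed.

Lemma parity_reversed1 : parity_reversed (1%:M : 'M[L]_(n + m)) = 1%:M.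
Proof.
rewrite [X in parity_reversed X]scalar_mx_block /parity_reversed.
by rewrite block_mxKul block_mxKur block_mxKdl block_mxKdr -scalar_mx_block.
Qed.

Lemma parity_reversed_diag (x : 'I_n -> L) (y : 'I_m -> L) :
  parity_reversed (block_mx (diag_mx (\row_a x a)) 0 0 (diag_mx (\row_mu y mu)))
  = \matrix_(i, j) (split_fun y x i *+ (i == j)).
Proof.
rewrite /parity_reversed block_mxKul block_mxKur block_mxKdl block_mxKdr.
apply/matrixP=> i j.
case: (split_ordP i) => i' ->; case: (split_ordP j) => j' ->.
- by rewrite block_mxEul !mxE split_fun_lshift (inj_eq (@lshift_inj _ _)).
- by rewrite block_mxEur !mxE eq_lrshift mulr0n.
- by rewrite block_mxEdl !mxE eq_rlshift mulr0n.
- by rewrite block_mxEdr !mxE split_fun_rshift (inj_eq (@rshift_inj _ _)).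
Qed.

Lemma Str_sym_power_eigen r (A P Q : 'M[L]_(n + m))
    (x : 'I_n -> Ev) (y : 'I_m -> Ev) (z : Ev) :
  smx_even P -> P *m Q = 1%:M -> Q *m P = 1%:M ->
  A *m P = P *m block_mx (diag_mx (\row_a val (x a))) 0 0 (diag_mx (\row_mu val (y mu))) ->
  val z ^+ r * (-1) ^+ r * Str (@sym_parity m n r) (sym_power (parity_reversed A)) =
  val (\sum_(b : sym_basis m n r)
     \prod_(a in (val b).2) (z * x a) * \prod_mu (- (z * y mu)) ^+ bmnm (val b).1 mu).
Proof.
move=> hP PQ QP AP; have hQ := smx_even_inv hP PQ QP.
set D := block_mx _ _ _ _ in AP.
have hd i : gr_homog false (split_fun (fun mu => val (y mu)) (fun a => val (x a)) i).
  by rewrite /split_fun; case: split => k; apply: even_gr_homog.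
have -> : A = P *m (D *m Q) by rewrite mulmxA -AP -mulmxA PQ mulmx1.
rewrite !parity_reversed_mulmx Str_sym_power_conj; first last.
- by rewrite -parity_reversed_mulmx QP parity_reversed1.
- exact: parity_reversed_even.
- exact: parity_reversed_even.
- rewrite parity_reversed_diag => i j; rewrite mxE; have [->|_] := eqVneq i j.
    by rewrite mulr1n addbb; apply: hd.
  by rewrite mulr0n; apply: gr_homog0.
rewrite parity_reversed_diag /Str rmorph_sum mulr_sumr; apply: eq_bigr => b _.
rewrite sym_power_diag //.
under eq_bigr do rewrite split_fun_rshift.
under [X in _ * (_ * (_ * X))]eq_bigr do rewrite split_fun_lshift.
have <- : z ^+ r * (-1) ^+ r * ((-1) ^+ sym_parity b *
    (\prod_(a in (val b).2) x a * \prod_mu y mu ^+ bmnm (val b).1 mu))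
  = \prod_(a in (val b).2) (z * x a) * \prod_mu (- (z * y mu)) ^+ bmnm (val b).1 mu.
  under [X in _ = _ * X]eq_bigr do rewrite -mulrN mulrC exprMn exprNn mulrC mulrA -exprMn.
  rewrite !big_split /= prodr_const -expr_sum -mdegE.
  have {1 2}-> : r = (mdeg (val b).1 + #|(val b).2|)%N by rewrite (eqP (valP b)).
  rewrite signr_odd !exprD exprMn; move: (sqrr_sign Ev #|(val b).2|).
  move: ((-1) ^+ #|(val b).2|) ((-1) ^+ mdeg _) (\prod_(a in _) _) (\prod_mu _).
  move=> s t X Y s2.
  exact: regroup_signs.
rewrite !rmorphM !rmorph_prod rmorphXn !rmorph_sign; congr (_ * (_ * (_ * _))).
by apply: eq_bigr => mu _; rewrite rmorphXn.
Qed.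

End SupertraceOfPower.

Lemma scalemx_central (S : pzRingType) a b c (z : S) (B : 'M[S]_(a, b)) (D : 'M[S]_(b, c)) :
  (forall w, z * w = w * z) -> z *: (B *m D) = B *m (z *: D).
Proof.
move=> zC; apply/matrixP=> i j; rewrite !mxE mulr_sumr; apply: eq_bigr => k _.
by rewrite mxE mulrA zC mulrA.
Qed.

Section Body.
Variables (R : realType) (N : nat).

(** The last of the y mu has the largest body. *)
Lemma norm_body_lt1 m (y : 'I_m -> grassmann R[i] N) (z : grassmann R[i] N) :
  (forall mu, y mu \is a GRing.unit) ->
  (forall mu nu : 'I_m, (mu < nu)%N -> `|body (y mu)| < `|body (y nu)|) ->
  (forall mu : 'I_m, mu.+1 = m -> `|body z| < 1 / `|body (y mu)|) ->
  forall mu, `|body (z * y mu)| < 1.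
Proof.
case: m y => [|m] y y_unit y_lt z_lt mu; first by case: mu.
have lt_last : `|body z| < 1 / `|body (y ord_max)| by apply: z_lt.
have y_gt0 nu : 0 < `|body (y nu)| by rewrite normr_gt0 -gr_unit_body.
rewrite rmorphM normrM.
apply: (@le_lt_trans _ _ (`|body z| * `|body (y ord_max)|)).
  apply: ler_wpM2l => //.
  have [->//|ne] := eqVneq mu ord_max; apply/ltW/y_lt.
  by rewrite ltn_neqAle -(inj_eq val_inj) /= in ne *; rewrite ne -ltnS /=.
by rewrite -ltr_pdivlMr.
Qed.

End Body.

Local Open Scope complex_scope.

Theorem theorem8p1 (R : realType) (N n m : nat)
    (A : 'M[grassmann R[i] N]_(n + m))
    (e : 'I_n -> 'cV[grassmann R[i] N]_(n + m))
    (eh : 'I_m -> 'cV[grassmann R[i] N]_(n + m))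
    (x : 'I_n -> grassmann R[i] N) (y : 'I_m -> grassmann R[i] N)
    (A_even : smx_even A) (A_inv : invertible A)
    (e_basis : homogeneous_basis e eh)
    (x_even : forall a, gr_homog false (x a))
    (y_even : forall mu, gr_homog false (y mu))
    (A_e : forall a, A *m e a = e a *m (x a)%:M)
    (A_eh : forall mu, A *m eh mu = eh mu *m (y mu)%:M)
    (y_unit : forall mu, y mu \is a GRing.unit)
    (y_sub_unit : forall mu nu, mu != nu -> y mu - y nu \is a GRing.unit)
    (y_lt : forall mu nu : 'I_m, (mu < nu)%N -> `|body (y mu)| < `|body (y nu)|)
    (z : grassmann R[i] N) (z_even : gr_homog false z)
    (z_near0 : forall mu : 'I_m, mu.+1 = m -> `|body z| < 1 / `|body (y mu)|) :
  gr_series_cvg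
    (fun r => z ^+ r * (-1) ^+ r *
       Str (@sym_parity m n r) (@sym_power _ N m n r (parity_reversed A)))
    (Ber (1%:M + z *: A)).
Proof.
have zy_lt1 := norm_body_lt1 y_unit y_lt z_near0.
have [Q [PQ QP]] := basis_mx_inv e_basis.
have P_even := basis_mx_even e_basis.
have AP := basis_mx_eigen A_e A_eh.
set P := basis_mx e eh in PQ QP P_even AP.
have zC w : z * w = w * z := gr_even_comm w z_even.
have zA_eigen : (1%:M + z *: A) *m P = P *m block_mx
    (diag_mx (\row_a (1 + z * x a))) 0 0 (diag_mx (\row_mu (1 + z * y mu))).
  have -> : block_mx (diag_mx (\row_a (1 + z * x a))) 0 0 (diag_mx (\row_mu (1 + z * y mu)))
      = 1%:M + z *: block_mx (diag_mx (\row_a x a)) 0 0 (diag_mx (\row_mu y mu)).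
    rewrite scale_block_mx !scaler0 scalar_mx_block add_block_mx !addr0.
    congr block_mx; apply/matrixP=> i j; rewrite !mxE;
      by case: (i == j); rewrite // mulr0 addr0.
  rewrite mulmxDl mulmxDr mul1mx mulmx1 -scalemxAl AP; congr (_ + _).
  exact: scalemx_central.
have M_even : smx_even (1%:M + z *: A).
  move=> i j; rewrite !mxE; apply: gr_homogD.
    have [->|_] := eqVneq i j; last exact: gr_homog0.
    by rewrite addbb; apply: gr_homog1.
  exact: (gr_homogM z_even (A_even i j)).
have even1D (w : grassmann R[i] N) : gr_homog false w -> gr_homog false (1 + z * w).
  by move=> hw; apply: gr_homogD; [apply: gr_homog1|apply: (gr_homogM z_even hw)].
have body1D mu : body (1 + z * y mu) != 0.
  rewrite rmorphD rmorph1 addrC addr_eq0.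
  by apply: contraTneq (zy_lt1 mu) => ->; rewrite normrN1 ltxx.
have -> : Ber (1%:M + z *: A) = (\prod_a (1 + z * x a)) / \prod_mu (1 + z * y mu).
  have hd1 : mx_homog false (\row_a (1 + z * x a)).
    by move=> i a; rewrite mxE; apply: even1D.
  have hd2 : mx_homog false (\row_mu (1 + z * y mu)).
    by move=> i mu; rewrite mxE; apply: even1D.
  have hd2_body mu : body ((\row_mu (1 + z * y mu)) 0 mu) != 0 by rewrite mxE.
  rewrite (Ber_eigen M_even P_even PQ hd1 hd2 hd2_body zA_eigen).
  by congr (_ / _); apply: eq_bigr => k _; rewrite mxE.
(* From here on the computation takes place in the commutative ring of even
   elements, where generating functions are polynomials. *)
have [x' xE] := even_lift x_even; have [y' yE] := even_lift y_even.
have [z' zE] : exists z' : even_gr R[i] N, z = val z'.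
  by have [f fE] := @even_lift _ _ unit (fun=> z) (fun=> z_even); exists (f tt).
pose c a := z' * x' a; pose u mu := - (z' * y' mu).
pose E := \prod_a (1 + c a *: 'X) : {poly even_gr R[i] N}.
pose us := [seq u mu | mu <- index_enum 'I_m].
have valN mu : val (u mu) = - (z * y mu) by rewrite zE yE.
have val1B mu : val (1 - u mu) = 1 + z * y mu.
  by rewrite -[in RHS](opprK (z * y mu)) -valN.
have us1 v : v \in us -> `|body (val v)| < 1.
  case/mapP=> mu _ ->; rewrite valN rmorphN normrN; exact: zy_lt1.
have ex : \row_a x a = \row_a val (x' a) by apply/rowP=> a; rewrite !mxE.
have ey : \row_mu y mu = \row_mu val (y' mu) by apply/rowP=> mu; rewrite !mxE.
rewrite ex ey in AP.
have termE r : z ^+ r * (-1) ^+ r *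
      Str (@sym_parity m n r) (sym_power (parity_reversed A))
    = val (geom_coef (fun k => E`_k) us r).
  have h := Str_sym_power_eigen r z' P_even PQ QP AP.
  by rewrite zE h sym_basis_sum -(geom_coefE _ _ (leqnn r)) big_map.
have limE : val (E.[1] * \prod_(v <- us) (1 - v)^-1)
    = (\prod_a (1 + z * x a)) / \prod_mu (1 + z * y mu).
  have unit1u mu : 1 - u mu \is a GRing.unit.
    by apply: even_gr_unit; rewrite gr_unit_body val1B.
  rewrite big_map (prodrV _ (fun mu _ => unit1u mu)).
  have unitW : \prod_mu (1 - u mu) \is a GRing.unit.
    by apply: rpred_prod => mu _; apply: unit1u.
  rewrite rmorphM (rmorphV _ unitW).
  rewrite horner_prod !rmorph_prod; congr (_ / _); apply: eq_bigr => k _.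
    by rewrite !hornerE zE xE.
  exact: val1B.
move=> S; rewrite -limE.
have -> : series (fun r => (z ^+ r * (-1) ^+ r *
      Str (@sym_parity m n r) (sym_power (parity_reversed A))) S : R[i]^o)
    = (fun M => val (\sum_(r < M) geom_coef (fun k => E`_k) us r) S : R[i]^o).
  apply: funext => M; rewrite /series /= big_mkord val_sum gr_sum.
  by apply: eq_bigr => r _; rewrite termE.
exact: (@gr_cvg_geom_coef R N E us us1 S).
Qed.
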